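(* Let $d$ be a square-free positive integer such that $E=\mathbb{Q}(\sqrt{-d})$ has class number at least $4$, and let $\mathcal{O}$ be its ring of integers. Let $\mathfrak{P}$ be a non-principal prime ideal of $\mathcal{O}$ and let $p$ be the prime number lying below $\mathfrak{P}$. Suppose $p$ is odd and $p\nmid d$. If $d\equiv 1,2\pmod 4$, let $n$ be the least positive integer with $-d\equiv n^2\pmod p$, and set $C=p(p-1)^2/4+(p-1)n+(d+n^2)/p+2pd$. If $d\equiv 3\pmod 4$, let $n$ be the least positive odd integer with $-d\equiv n^2\pmod p$, and set $C=p(p-1)^2/4+(p-1)n+(d+n^2)/p+p(d+1)/4$. Then for every positive integer $r\geq C$, the unary Hermitian lattice $\mathfrak{P}v$, where $v$ spans a one-dimensional Hermitian space over $E$ with $h(v)=r/p$, is represented by $I_4$.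
   Context: A Hermitian space is a finite-dimensional $E$-vector space with a map $h$ that is $E$-linear in the first argument and satisfies $h(v,w)=\overline{h(w,v)}$; $h(v):=h(v,v)$. $I_4$ is the Hermitian lattice $\mathcal{O}^4$ with $h(x,y)=\sum_{i=1}^4 x_i\overline{y_i}$. A lattice $L$ is represented by $I_4$ if there is an injective $\mathcal{O}$-linear map $L\to I_4$ preserving $h$. *)

(* Defs.v *)
From HB Require Import structures.
From mathcomp Require Import all_boot all_order all_algebra all_field.
Set Implicit Arguments. Unset Strict Implicit. Unset Printing Implicit Defensive.
Import Order.TTheory GRing.Theory Num.Theory.
Local Open Scope ring_scope.

(* Everything lives inside algC, the algebraic closure of Q (with complex
   conjugation conjC.  E = Q(sqrt(-d)) is realised as a subfield of algC. *)

Definition squarefree (d : nat) : Prop := forall m : nat, (1 < m)%N -> ~ (m * m %| d)%N.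

Definition sqrtmd (d : nat) : algC := sqrtC (- (d%:R)).

Definition inE (d : nat) (x : algC) : Prop :=
  exists a b : rat, x = ratr a + ratr b * sqrtmd d.

Definition inO (d : nat) (x : algC) : Prop := inE d x /\ x \in Aint.

Definition is_ideal (d : nat) (I : algC -> Prop) : Prop :=
  (forall x, I x -> inO d x) /\ I 0 /\
  (forall x y, I x -> I y -> I (x + y)) /\
  (forall a x, inO d a -> I x -> I (a * x)).

Definition nonzero_ideal (d : nat) (I : algC -> Prop) : Prop :=
  is_ideal d I /\ exists x, I x /\ x != 0.

Definition is_prime_ideal (d : nat) (P : algC -> Prop) : Prop :=
  is_ideal d P /\ ~ P 1 /\
  (forall x y, inO d x -> inO d y -> P (x * y) -> P x \/ P y).

Definition is_principal (d : nat) (I : algC -> Prop) : Prop :=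
  exists a, inO d a /\ forall x, I x <-> exists b, inO d b /\ x = a * b.

Definition ideal_equiv (d : nat) (I J : algC -> Prop) : Prop :=
  exists a b, inO d a /\ inO d b /\ a != 0 /\ b != 0 /\
    forall x, (exists y, I y /\ x = a * y) <-> (exists z, J z /\ x = b * z).

Definition class_number_ge4 (d : nat) : Prop :=
  exists I : 'I_4 -> (algC -> Prop),
    (forall i, nonzero_ideal d (I i)) /\
    (forall i j, i != j -> ~ ideal_equiv d (I i) (I j)).

(* A lattice L (an O-submodule of a Hermitian space, given by its elements
   and its form hL) is represented by I_4 = O^4 with the standard form. *)
Definition represented_by_I4 (d : nat) (L : algC -> Prop)
    (hL : algC -> algC -> algC) : Prop :=
  exists sigma : algC -> 'I_4 -> algC,
    (forall x, L x -> forall i, inO d (sigma x i)) /\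
    (forall a x y, inO d a -> L x -> L y ->
        forall i, sigma (a * x + y) i = a * sigma x i + sigma y i) /\
    (forall x y, L x -> L y -> sigma x = sigma y -> x = y) /\
    (forall x y, L x -> L y ->
        \sum_(i < 4) sigma x i * (sigma y i)^* = hL x y).

(* The unary Hermitian space E v with h(v) = c: identifying a v with a,
   h(a v, b v) = a * b^* * c. *)
Definition unary_form (c : algC) (x y : algC) : algC := x * y^* * c.

Definition boundC (d p n : nat) : rat :=
  (p%:R * (p%:R - 1) ^+ 2 / 4 + (p%:R - 1) * n%:R
   + (d%:R + n%:R ^+ 2) / p%:R
   + if (d %% 4 == 3)%N then p%:R * (d%:R + 1) / 4 else 2 * p%:R * d%:R)%R.

Definition admissible_n (d p m : nat) : bool :=
  [&& (0 < m)%N, (p %| m ^ 2 + d)%N & ((d %% 4 == 3)%N ==> odd m)].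

Definition least_n (d p n : nat) : Prop :=
  admissible_n d p n /\ forall m : nat, admissible_n d p m -> (n <= m)%N.

(* Main.v *)
Require Import Defs.
From HB Require Import structures.
From mathcomp Require Import all_boot all_order all_algebra all_field.
From mathcomp Require Import zify ring.
From mathcomp Require Import boolp classical_sets functions cardinality fsbigop.
Set Implicit Arguments. Unset Strict Implicit. Unset Printing Implicit Defensive.
Import Order.TTheory GRing.Theory Num.Theory.
Local Open Scope classical_set_scope.
Local Open Scope ring_scope.

(* Let nu be n + sqrt(-d), halved if d = 3 mod 4, and let T and p K be its trace
   and norm.  As nu * nu^* lies in P, we may assume that nu does (otherwise
   exchange sqrt(-d) and - sqrt(-d)); then every x in P is c + e nu with c in pZ,
   so x nu^* / p is in O.  Hence x |-> (x (a + nu^* / p), x x1, x x2, x x3) maps P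
   to O^4 for all a in Z and x1, x2, x3 in O, and it represents the lattice as
   soon as r = p a^2 + a T + K + p (N x1 + N x2 + N x3).  Choosing a mod p with
   |a| <= (p - 1) / 2 makes this r = p a^2 + a T + K + p M, and r >= C gives
   M >= 2d, resp. 4M >= d + 1.  If d = 1, 2 mod 4, then M, M - d or M - 2d is
   1 or 2 mod 4, hence a sum of three squares; if d = 3 mod 4, so is 4M - d, and
   these squares give x1, x2, x3 with N x1 + N x2 + N x3 = M.

   For m = 1, 2 mod 4 the number r3(m) of representations of m by three squares
   (with the parity pattern x <> y = z) equals a weighted number of reduced binary
   forms of determinant m, which is visibly positive.  Indeed both functions f
   satisfy
     \sum_(s even) f(n - s^2) = 2 sigma(n) if n = 1 mod 4, 4 sigma(n/2) if n = 2 mod 4: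
   for r3 this is Jacobi's four-square theorem, for the forms it is a class number
   relation of Kronecker, and both are obtained here from bijections between
   finite sets of integer points. *)

(** * Finitely supported sums of integers *)

Lemma fsum_bij (I J : choiceType) (A : set I) (B : set J)
    (F : I -> int) (G : J -> int) (h : I -> J) (k : J -> I) :
  (forall i, A i -> [/\ B (h i), k (h i) = i & F i = G (h i)]) ->
  (forall j, B j -> A (k j) /\ h (k j) = j) ->
  \sum_(i \in A) F i = \sum_(j \in B) G j.
Proof.
move=> hA kB; rewrite (@reindex_fsbig _ _ _ _ _ h A B); last first.
  split=> [i /hA[] // | x y | y /kB[Ak hk]]; last by exists (k y).
  by rewrite !inE => /hA[_ kx _] /hA[_ ky _] hxy; rewrite -kx hxy ky.
by apply: eq_fsbigr => i; rewrite inE => /hA[].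
Qed.

Lemma fsum_split (I : choiceType) (C : set I) (A : set I) (F : I -> int) :
  finite_set A ->
  \sum_(i \in A) F i = \sum_(i \in [set i | A i /\ C i]) F i
                     + \sum_(i \in [set i | A i /\ ~ C i]) F i.
Proof. exact: fsbigID. Qed.

Lemma fsumD (I : choiceType) (A : set I) (F G : I -> int) : finite_set A ->
  \sum_(i \in A) (F i + G i) = \sum_(i \in A) F i + \sum_(i \in A) G i.
Proof. exact: fsbig_split. Qed.

Lemma fsumZ (I : choiceType) (A : set I) (F : I -> int) c :
  \sum_(i \in A) (c * F i) = c * \sum_(i \in A) F i.
Proof. by rewrite mulr_fsumr. Qed.

Lemma fsumB (I : choiceType) (A : set I) (F G : I -> int) : finite_set A ->
  \sum_(i \in A) (F i - G i) = \sum_(i \in A) F i - \sum_(i \in A) G i.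
Proof.
move=> fA; rewrite fsumD//; congr (_ + _); rewrite -mulN1r -fsumZ.
by apply: eq_fsbigr => i _; rewrite mulN1r.
Qed.

Lemma eq_fsum (I : choiceType) (A B : set I) (F G : I -> int) :
  (forall i, A i <-> B i) -> (forall i, A i -> F i = G i) ->
  \sum_(i \in A) F i = \sum_(i \in B) G i.
Proof.
move=> AB FG; have -> : B = A by apply/seteqP; split=> i /AB.
by apply: eq_fsbigr => i; rewrite inE => /FG.
Qed.

Lemma fsum_widen (I : choiceType) (A B : set I) (F G : I -> int) :
  (forall i, A i -> B i /\ F i = G i) -> (forall i, B i -> ~ A i -> G i = 0) ->
  \sum_(i \in A) F i = \sum_(i \in B) G i.
Proof.
move=> AB G0; rewrite -(@fsbig_widen _ _ _ _ A B) => [|i /AB[]//|i [/G0 /[apply]//]].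
by apply: eq_fsum => // i /AB[].
Qed.

(** The involution exchanges [C] with its complement and preserves [F], so both halves have the same
    sum. It serves to normalise signs. *)
Lemma fsum_involution (I : choiceType) (A C : set I) (F : I -> int) (h : I -> I) :
  finite_set A ->
  (forall i, A i -> [/\ A (h i), h (h i) = i, F (h i) = F i & C (h i) <-> ~ C i]) ->
  \sum_(i \in A) F i = 2 * \sum_(i \in [set i | A i /\ C i]) F i.
Proof.
move=> fA hA; rewrite (fsum_split C)// mulr_natl mulr2n; congr (_ + _).
apply: (@fsum_bij _ _ _ _ _ _ h h) => i /= [Ai Ci]; have [Ah hh Fh Ch] := hA _ Ai.
  by split=> //; split=> //; apply/Ch.
by split=> //; split=> // /Ch.
Qed.

Lemma fsum_fiber (I K : choiceType) (A : set I) (D : set K) (f : I -> K) (F : I -> int) :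
  finite_set A -> finite_set D -> (forall i, A i -> D (f i)) ->
  \sum_(i \in A) F i = \sum_(k \in D) \sum_(i \in [set i | A i /\ f i = k]) F i.
Proof.
move=> fA fD AD.
(* With an indicator of [f i = k] every inner sum ranges over all of [A], and the order of summation
   can be exchanged. *)
transitivity (\sum_(k \in D) \sum_(i \in A) (if f i == k then F i else 0)); last first.
  apply: eq_fsbigr => k _; apply/esym/fsum_widen => [i /= [Ai ->]|i Ai /=].
    by rewrite eqxx.
  by case: eqP => // fi; case.
rewrite !fsbig_finite//=.
under [RHS]eq_bigr => k _ do rewrite fsbig_finite//=.
rewrite exchange_big /= big_seq [RHS]big_seq; apply: eq_bigr => i.
rewrite in_fset_set// inE => Ai.
rewrite (bigD1_seq (f i))/= ?fset_uniq//; last by rewrite in_fset_set// inE; exact: AD.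
rewrite eqxx big1 ?addr0// => k kfi; rewrite eq_sym (negPf kfi) //.
Qed.

(** * Finiteness of bounded sets of integer points *)

Lemma finite_int_itv (B : int) : finite_set [set x : int | - B <= x <= B].
Proof.
have: finite_set ((fun k : nat => k%:Z - `|B|) @` `I_(2 * `|B| + 1)%N).
  exact/finite_image/finite_II.
apply: sub_finite_set => x /= xB; exists (absz (x + `|B|)) => /=; lia.
Qed.

Lemma finite_box1 (B : int) (A : set int) :
  (forall x, A x -> - B <= x <= B) -> finite_set A.
Proof. by move=> h; apply: sub_finite_set (finite_int_itv B). Qed.

Lemma finite_box2 (B : int) (A : set (int * int)) :
  (forall x, A x -> - B <= x.1 <= B /\ - B <= x.2 <= B) -> finite_set A.
Proof.
move=> h; apply: sub_finite_set (finite_setX (finite_int_itv B) (finite_int_itv B)).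
by move=> x /h.
Qed.

Lemma finite_box3 (B : int) (A : set (int * int * int)) :
  (forall x, A x -> [/\ - B <= x.1.1 <= B, - B <= x.1.2 <= B & - B <= x.2 <= B]) ->
  finite_set A.
Proof.
move=> h; apply: sub_finite_set (finite_setX (finite_setX (finite_int_itv B)
  (finite_int_itv B)) (finite_int_itv B)).
by move=> x /h[].
Qed.

Lemma finite_box4 (B : int) (A : set (int * int * int * int)) :
  (forall x, A x -> [/\ - B <= x.1.1.1 <= B, - B <= x.1.1.2 <= B,
     - B <= x.1.2 <= B & - B <= x.2 <= B]) ->
  finite_set A.
Proof.
move=> h; apply: sub_finite_set (finite_setX (finite_setX (finite_setX
  (finite_int_itv B) (finite_int_itv B)) (finite_int_itv B)) (finite_int_itv B)).
by move=> x /h[].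
Qed.

Lemma finite_box5 (B : int) (A : set (int * int * int * int * int)) :
  (forall x, A x -> [/\ - B <= x.1.1.1.1 <= B, - B <= x.1.1.1.2 <= B,
     - B <= x.1.1.2 <= B, - B <= x.1.2 <= B & - B <= x.2 <= B]) ->
  finite_set A.
Proof.
move=> h; apply: sub_finite_set (finite_setX (finite_setX (finite_setX (finite_setX
  (finite_int_itv B) (finite_int_itv B)) (finite_int_itv B)) (finite_int_itv B))
  (finite_int_itv B)).
by move=> x /h[].
Qed.

Lemma fsum_itv (w : int) : 0 <= w -> \sum_(i \in [set i : int | 0 <= i < w]) (1 : int) = w.
Proof.
case: w => // n _; transitivity (\sum_(i \in `I_n) (1 : int)).
  apply: (@fsum_bij _ _ _ _ _ _ (fun i : int => `|i|%N) (fun k : nat => k%:Z)) => [i|k] /=.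
    by move=> ?; split=> //; lia.
  by move=> ?; split; lia.
by rewrite -(fsbig_ord _ _ (fun=> 1)) sumr_const card_ord; lia.
Qed.

(** * Jacobi's four-square theorem *)

Lemma sqr_le_itv (x B : int) : x * x <= B -> - B <= x <= B.
Proof. by nia. Qed.

Lemma sqr4_itv (y : int) :
  - ((4 * y + 1) * (4 * y + 1)) <= y <= (4 * y + 1) * (4 * y + 1).
Proof. have y1 : y <= y * y by nia. have y2 : - y <= y * y by nia. lia. Qed.

Lemma sqr4_ge1 (y : int) : 1 <= (4 * y + 1) * (4 * y + 1).
Proof. have y2 : - y <= y * y by nia. have : 0 <= y * y by rewrite sqr_ge0. lia. Qed.

Lemma sqr4_eq1 (y : int) : (4 * y + 1) * (4 * y + 1) <= 1 -> y = 0.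
Proof.
move=> h; have y1 : - y <= y * y by nia.
have y2 : y <= y * y by nia.
lia.
Qed.

(** The sum of divisors, taken over factorisations so that bijections of pairs apply and the value
    is 0 for [n <= 0]. *)
Definition sigma (n : int) : int :=
  \sum_(x \in [set x : int * int | [/\ 0 < x.1, 0 < x.2 & x.1 * x.2 = n]]) x.1.

Lemma finite_divisor_pairs n :
  finite_set [set x : int * int | [/\ 0 < x.1, 0 < x.2 & x.1 * x.2 = n]].
Proof. by apply: (@finite_box2 n) => -[d D] [/= d0 D0 dD]; split=> /=; nia. Qed.

(** For fixed [X] the pairs [(d, D)] are the factorisations of [(N - X^2) / 4], so sums over this
    set become sums of values of [sigma]. *)
Definition zagier_set (N : int) : set (int * int * int) := [set x : int * int * int |
  [/\ (x.1.1 %% 2)%Z = 1, 0 < x.1.2, 0 < x.2 & x.1.1 * x.1.1 + 4 * x.1.2 * x.2 = N]].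

Lemma finite_zagier_set N : finite_set (zagier_set N).
Proof.
apply: (@finite_box3 N) => -[[X d] D] [/= _ d0 D0 e].
have X0 : 0 <= X * X by nia.
have dD : d <= d * D by nia.
have Dd : D <= d * D by nia.
by split=> /=; [apply: sqr_le_itv; lia | lia | lia].
Qed.

(** As [X^2] is 1 mod 8, the product [d D] is odd, and so are [d] and [D]. Hence [d <> D + X]: no
    point lies between the two halves exchanged by Zagier's map. *)
Lemma zagier_odd N X d D : (N %% 8)%Z = 5 -> zagier_set N (X, d, D) ->
  ((X + D - d) %% 2)%Z = 1.
Proof.
move=> N5 [/= X1 d0 D0 e].
have [x ex] : exists x, X = 2 * x + 1 by exists (X %/ 2)%Z; lia.
have [y ey] : exists y, d = 2 * y + (d %% 2)%Z by exists (d %/ 2)%Z; lia.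
have [z ez] : exists z, D = 2 * z + (D %% 2)%Z by exists (D %/ 2)%Z; lia.
have [w ew] : exists w, x * (x + 1) = 2 * w.
  exists ((x * (x + 1)) %/ 2)%Z; have [x0|x0] : (x %% 2)%Z = 0 \/ (x %% 2)%Z = 1 by lia.
    have [v ->] : exists v, x = 2 * v by exists (x %/ 2)%Z; lia.
    lia.
  have [v ->] : exists v, x = 2 * v + 1 by exists (x %/ 2)%Z; lia.
  lia.
have hd : (d %% 2)%Z = 0 \/ (d %% 2)%Z = 1 by lia.
have hD : (D %% 2)%Z = 0 \/ (D %% 2)%Z = 1 by lia.
case: hd ey => -> ey; case: hD ez => -> ez; subst X d D; lia.
Qed.

(* Zagier's map [(X, d, D) |-> (X - 2d, D + X - d, d)] sends the half [d < D + X] of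
   the set onto the half [D + X < d], and it changes the sign of the polynomial [F]. *)
Lemma zagier_sum0 N : (N %% 8)%Z = 5 ->
  \sum_(x \in zagier_set N) (x.1.2 * (x.1.2 * x.2 - x.1.1 * x.1.1)) = 0.
Proof.
move=> N5; have fZ := finite_zagier_set N.
pose F (x : int * int * int) : int := let: (X, d, D) := x in
  d * d * D - d * X * X + D * D * D - d * d * d + X * D * D + 2 * X * d * d.
have F0 : \sum_(x \in zagier_set N) F x = 0.
  rewrite (fsum_split [set x | x.1.2 < x.2 + x.1.1])//.
  rewrite [X in _ + X](_ : _ = \sum_(x \in [set x | zagier_set N x /\
      [set x | x.1.2 < x.2 + x.1.1] x]) - F x).
    rewrite -fsumD; last by apply: sub_finite_set fZ => x [].
    by apply: fsbig1 => x _; rewrite subrr.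
  apply/esym; apply: (@fsum_bij _ _ _ _ _ _
    (fun x => (x.1.1 - 2 * x.1.2, x.2 + x.1.1 - x.1.2, x.1.2))
    (fun x => (x.1.1 + 2 * x.2, x.2, x.1.2 - x.1.1 - x.2))) => -[[X d] D] /= [zX].
    have := zagier_odd N5 zX; case: zX => [/= X1 d0 D0 e] odd lt.
    by split=> /=; [split=> /=; [split=> /=; lia | lia] | congr (_, _, _); lia | ring].
  have := zagier_odd N5 zX; case: zX => [/= X1 d0 D0 e] odd lt.
  by split=> /=; [split=> /=; [split=> /=; lia | lia] | congr (_, _, _); lia].
(* [F] differs from the wanted summand by [D^3 - d^3], which cancels on swapping [d] and [D], and by
   [G], which is odd in [X]. *)
pose cub (x : int * int * int) : int := x.2 * x.2 * x.2.
have cub0 : \sum_(x \in zagier_set N) cub x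
          = \sum_(x \in zagier_set N) (x.1.2 * x.1.2 * x.1.2).
  apply: (@fsum_bij _ _ _ _ _ _ (fun x => (x.1.1, x.2, x.1.2))
    (fun x => (x.1.1, x.2, x.1.2))) => -[[X d] D] [/= X1 d0 D0 e].
    by split=> /=; [split=> /=; lia | | rewrite /cub/=; ring].
  by split=> //=; split=> /=; lia.
pose G (x : int * int * int) : int := x.1.1 * (x.2 * x.2 + 2 * x.1.2 * x.1.2).
have G0 : \sum_(x \in zagier_set N) G x = 0.
  suff : \sum_(x \in zagier_set N) G x = - \sum_(x \in zagier_set N) G x by lia.
  rewrite -mulN1r -fsumZ.
  apply: (@fsum_bij _ _ _ _ _ _ (fun x => (- x.1.1, x.1.2, x.2))
    (fun x => (- x.1.1, x.1.2, x.2))) => -[[X d] D] [/= X1 d0 D0 e].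
    by split=> /=; [split=> /=; lia | rewrite opprK | rewrite /G/=; ring].
  by split=> /=; [split=> /=; lia | rewrite opprK].
transitivity (\sum_(x \in zagier_set N) (F x - (cub x - x.1.2 * x.1.2 * x.1.2) - G x)).
  by apply: eq_fsbigr => -[[X d] D] _; rewrite /F /cub /G /=; ring.
by rewrite (fsumB _ _ fZ) (fsumB _ _ fZ) (fsumB _ _ fZ) F0 cub0 G0 !subrr.
Qed.

(* Every odd integer is, up to sign, [4 * y + 1] for a unique [y]. *)
Definition odd_squares4 (k : int) : set (int * int * int * int) := [set x : int * int * int * int |
  let sq y := (4 * y + 1) * (4 * y + 1) in
  sq x.1.1.1 + sq x.1.1.2 + sq x.1.2 + sq x.2 = 4 * k].

(** One sixteenth of the number of representations of [4 k] by four odd squares, since all signs are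
    normalised. *)
Definition tau4 (k : int) : int := \sum_(x \in odd_squares4 k) (1 : int).

Definition odd_squares5 (N : int) : set (int * int * int * int * int) :=
  [set x : int * int * int * int * int |
  let sq y := (4 * y + 1) * (4 * y + 1) in
  sq x.1.1.1.1 + sq x.1.1.1.2 + sq x.1.1.2 + sq x.1.2 + sq x.2 = N].

Lemma finite_odd_squares5 N : finite_set (odd_squares5 N).
Proof.
apply: (@finite_box5 N) => -[[[[a b] c] d] f]; rewrite /odd_squares5/= => e.
move: (sqr4_itv a) (sqr4_itv b) (sqr4_itv c) (sqr4_itv d) (sqr4_itv f).
by split=> /=; lia.
Qed.

(* By symmetry, each of the five squares has average [N / 5]. *)
Lemma odd_squares5_sum0 N :
  \sum_(x \in odd_squares5 N) (N - 5 * ((4 * x.2 + 1) * (4 * x.2 + 1))) = 0.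
Proof.
have fS := finite_odd_squares5 N.
pose sq (y : int) := (4 * y + 1) * (4 * y + 1).
set S := \sum_(x \in _) _.
pose T := \sum_(x \in odd_squares5 N) sq x.2.
have e1 : \sum_(x \in odd_squares5 N) sq x.1.1.1.1 = T.
  apply: (@fsum_bij _ _ _ _ _ _ (fun x => (x.2, x.1.1.1.2, x.1.1.2, x.1.2, x.1.1.1.1))
    (fun x => (x.2, x.1.1.1.2, x.1.1.2, x.1.2, x.1.1.1.1)))
    => -[[[[a b] c] d] f]; rewrite /odd_squares5/= => e.
    by split=> //=; rewrite -e; ring.
  by split=> //=; rewrite -e; ring.
have e2 : \sum_(x \in odd_squares5 N) sq x.1.1.1.2 = T.
  apply: (@fsum_bij _ _ _ _ _ _ (fun x => (x.1.1.1.1, x.2, x.1.1.2, x.1.2, x.1.1.1.2))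
    (fun x => (x.1.1.1.1, x.2, x.1.1.2, x.1.2, x.1.1.1.2)))
    => -[[[[a b] c] d] f]; rewrite /odd_squares5/= => e.
    by split=> //=; rewrite -e; ring.
  by split=> //=; rewrite -e; ring.
have e3 : \sum_(x \in odd_squares5 N) sq x.1.1.2 = T.
  apply: (@fsum_bij _ _ _ _ _ _ (fun x => (x.1.1.1.1, x.1.1.1.2, x.2, x.1.2, x.1.1.2))
    (fun x => (x.1.1.1.1, x.1.1.1.2, x.2, x.1.2, x.1.1.2)))
    => -[[[[a b] c] d] f]; rewrite /odd_squares5/= => e.
    by split=> //=; rewrite -e; ring.
  by split=> //=; rewrite -e; ring.
have e4 : \sum_(x \in odd_squares5 N) sq x.1.2 = T.
  apply: (@fsum_bij _ _ _ _ _ _ (fun x => (x.1.1.1.1, x.1.1.1.2, x.1.1.2, x.2, x.1.2))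
    (fun x => (x.1.1.1.1, x.1.1.1.2, x.1.1.2, x.2, x.1.2)))
    => -[[[[a b] c] d] f]; rewrite /odd_squares5/= => e.
    by split=> //=; rewrite -e; ring.
  by split=> //=; rewrite -e; ring.
have : S = T + T + T + T + T - 5 * T.
  rewrite -{1}e1 -{1}e2 -{1}e3 -{1}e4 -fsumZ -!fsumD// -fsumB//.
  by apply: eq_fsbigr => -[[[[a b] c] d] f]; rewrite inE /= /sq => <-; ring.
by move=> ->; ring.
Qed.

(** Sort the five odd squares with sum [4 k + 1] by the last one, [(4 y + 1)^2]: the other four have
    sum [4 (k - 4 y^2 - 2 y)]. The bound [k <= B] makes the range of [y] large enough. *)
Lemma tau4_recurrence (B k : int) : k <= B ->
  \sum_(y \in [set y : int | - B <= y <= B])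
    ((4 * k + 1 - 5 * ((4 * y + 1) * (4 * y + 1))) * tau4 (k - 4 * y * y - 2 * y)) = 0.
Proof.
move=> kB; rewrite -[RHS](odd_squares5_sum0 (4 * k + 1)).
rewrite [RHS](@fsum_fiber _ _ _ [set y : int | - B <= y <= B] (fun x => x.2)).
- apply: eq_fsbigr => y _; rewrite /tau4 -fsumZ.
  apply/esym; apply: (@fsum_bij _ _ _ _ _ _ (fun x => x.1) (fun x => (x, y)))
    => [[[[[a b] c] d] f]|[[[a b] c] d]] /=.
    move=> []; rewrite /odd_squares5/= => e fy; subst f.
    by split=> //=; [rewrite /odd_squares4/=; lia | ring].
  by rewrite /odd_squares4/= => e; split=> //=; split=> //=; rewrite /odd_squares5/=; lia.
- exact: finite_odd_squares5.
- exact: finite_int_itv.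
- move=> -[[[[a b] c] d] f]; rewrite /odd_squares5/= => e.
  have sq_ge0 (y : int) : 0 <= (4 * y + 1) * (4 * y + 1) by rewrite -expr2 sqr_ge0.
  move: (sq_ge0 a) (sq_ge0 b) (sq_ge0 c) (sq_ge0 d).
  have f1 : - f <= f * f by nia.
  have f2 : f <= f * f by nia.
  lia.
Qed.

(** This is [zagier_sum0] for [N = 4 k + 1], sorted by [X]. The symmetry [X |-> - X] allows
    [X = 4 y + 1], and then [d D = k - 4 y^2 - 2 y]. *)
Lemma sigma_recurrence (B k : int) : k <= B -> (k %% 2)%Z = 1 ->
  \sum_(y \in [set y : int | - B <= y <= B])
    ((4 * k + 1 - 5 * ((4 * y + 1) * (4 * y + 1))) * sigma (k - 4 * y * y - 2 * y)) = 0.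
Proof.
move=> kB k1; have N5 : ((4 * k + 1) %% 8)%Z = 5 by lia.
have := zagier_sum0 N5; have fZ := finite_zagier_set (4 * k + 1).
rewrite (@fsum_involution _ _ [set x | (x.1.1 %% 4)%Z = 1] _
  (fun x => (- x.1.1, x.1.2, x.2)))//; last first.
  move=> -[[X d] D] [/= X1 d0 D0 e].
  by split=> /=; [split=> /=; lia | rewrite opprK | ring | lia].
(* The factor 4 turns [d D - X^2] into [N - 5 X^2]. *)
set S := \sum_(x \in _) _ => S0; have {S0} S0 : 4 * S = 0 by lia.
rewrite -[RHS]S0 /S -fsumZ.
rewrite [RHS](@fsum_fiber _ _ _ [set y : int | - B <= y <= B] (fun x => (x.1.1 %/ 4)%Z)).
- apply: eq_fsbigr => y _; rewrite /sigma -fsumZ.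
  apply: (@fsum_bij _ _ _ _ _ _ (fun x => (4 * y + 1, x.1, x.2))
    (fun x => (x.1.2, x.2))) => [[d D]|[[X d] D]] /=.
    move=> [/= d0 D0 e]; split=> //=; last lia.
    by split=> /=; [split=> /=; [split=> /=; lia | lia] | lia].
  move=> [[[/= X1 d0 D0 e] X4] ey]; have eX : X = 4 * y + 1 by lia.
  by subst X; split=> //=; split=> /=; lia.
- by apply: sub_finite_set fZ => x [].
- exact: finite_int_itv.
- move=> -[[X d] D] [[/= X1 d0 D0 e] /= X4].
  have [y ey] : exists y, X = 4 * y + 1 by exists (X %/ 4)%Z; lia.
  subst X; have f1 : - y <= y * y by nia.
  have f2 : y <= y * y by nia.
  have : 0 < d * D by nia.
  lia.
Qed.

Lemma tau4_nonpos k : k <= 0 -> tau4 k = 0.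
Proof.
move=> k0; apply: fsbig1 => -[[[a b] c] d]; rewrite /odd_squares4/= => e.
by move: (sqr4_ge1 a) (sqr4_ge1 b) (sqr4_ge1 c) (sqr4_ge1 d); lia. Qed.

Lemma sigma_nonpos k : k <= 0 -> sigma k = 0.
Proof. by move=> k0; apply: fsbig1 => -[d D] [/= d0 D0 e]; nia. Qed.

Lemma tau4_1 : tau4 1 = sigma 1.
Proof.
rewrite /tau4 /sigma; apply: (@fsum_bij _ _ _ _ _ _ (fun=> (1, 1)) (fun=> (0, 0, 0, 0)))
  => [[[[a b] c] d]|[d D]] /=.
  rewrite /odd_squares4/= => e; have [/= ha hb hc hd] : [/\ a = 0, b = 0, c = 0 & d = 0].
    by move: (sqr4_ge1 a) (sqr4_ge1 b) (sqr4_ge1 c) (sqr4_ge1 d); split; apply: sqr4_eq1; lia.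
  by split=> //=; congr (_, _, _, _).
by move=> [/= d0 D0 e]; split=> //=; congr (_, _); nia.
Qed.

(* Both sides satisfy the same recurrence, in which the term [y = 0] has the
   coefficient [4 * (k - 1)] and the others only involve smaller arguments. *)
Lemma tau4E k : (k %% 2)%Z = 1 -> tau4 k = sigma k.
Proof.
have [B kB] : exists B : nat, k <= B by exists `|k|%N; lia.
elim: B => [|B IH] in k kB * => k1.
  by rewrite tau4_nonpos// sigma_nonpos.
(* For [k = 1] the coefficient of the term [y = 0] vanishes, so this value is computed directly. *)
have [->|kn1] := eqVneq k 1; first exact: tau4_1.
have := tau4_recurrence kB; have := sigma_recurrence kB k1.
set D := [set y | _].
have fD : finite_set D := finite_int_itv _.
have D0 : D 0 by rewrite /D /=; lia.
rewrite !(@fsbigD1 _ _ _ _ 0 D)//=.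
set s1 := \sum_(_ \in _) _; set s2 := \sum_(_ \in _) _ => h1 h2.
have es : s1 = s2.
  apply: eq_fsbigr => y; rewrite inE => -[/= yB /eqP y0]; congr (_ * _).
  have y1 : - y <= y * y by nia.
  have y2 : y <= y * y by nia.
  by apply/esym/IH; lia.
suff : (k - 1) * (tau4 k - sigma k) = 0.
  by move/eqP; rewrite mulf_eq0 !subr_eq0 (negPf kn1) => /eqP.
move: h1 h2; rewrite es !(mulr0, subr0); lia.
Qed.

(** * Sums of four squares with prescribed parities *)

Lemma sqr_mod4 (x : int) : ((x * x) %% 4)%Z = (x %% 2)%Z.
Proof.
have [e|e] : x = 2 * (x %/ 2)%Z \/ x = 2 * (x %/ 2)%Z + 1 by lia.
  by move: (x %/ 2)%Z e => y ->; lia.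
by move: (x %/ 2)%Z e => y ->; lia.
Qed.

(** Fixing the last, even, entry [s] leaves the triples counted by [r3 (n - s * s)]. *)
Definition mixed4 (n : int) : set (int * int * int * int) := [set x |
  [/\ ((x.1.1.2 - x.1.1.1) %% 2)%Z = 1, ((x.1.2 - x.1.1.2) %% 2)%Z = 0, (x.2 %% 2)%Z = 0 &
   x.1.1.1 * x.1.1.1 + x.1.1.2 * x.1.1.2 + x.1.2 * x.1.2 + x.2 * x.2 = n]].

Lemma finite_mixed4 n : finite_set (mixed4 n).
Proof.
apply: (@finite_box4 n) => -[[[x y] z] s] [/= _ _ _ e].
have sq_ge0 (t : int) : 0 <= t * t by rewrite -expr2 sqr_ge0.
by move: (sq_ge0 x) (sq_ge0 y) (sq_ge0 z) (sq_ge0 s); split; apply: sqr_le_itv; lia.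
Qed.

(* Apply to [(x, y, z, s)] the Hadamard matrix of order 4; replacing [x] by [- x]
   makes the four resulting odd integers 1 mod 4. *)
Lemma card_mixed4_1mod4 n : (n %% 4)%Z = 1 ->
  \sum_(x \in mixed4 n) (1 : int) = 2 * sigma n.
Proof.
move=> n1; rewrite -tau4E; last lia.
rewrite (@fsum_involution _ _ [set x | ((x.1.1.1 - 1 + x.1.1.2 + x.1.2 + x.2) %% 4)%Z = 0] _
  (fun x => (- x.1.1.1, x.1.1.2, x.1.2, x.2)))//.
- congr (_ * _); apply: (@fsum_bij _ _ _ _ _ _
    (fun x => (((x.1.1.1 - 1 + x.1.1.2 + x.1.2 + x.2) %/ 4)%Z,
               ((x.1.1.1 - 1 + x.1.1.2 - x.1.2 - x.2) %/ 4)%Z,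
               ((x.1.1.1 - 1 - x.1.1.2 + x.1.2 - x.2) %/ 4)%Z,
               ((x.1.1.1 - 1 - x.1.1.2 - x.1.2 + x.2) %/ 4)%Z))
    (fun x => (1 + x.1.1.1 + x.1.1.2 + x.1.2 + x.2, x.1.1.1 + x.1.1.2 - x.1.2 - x.2,
       x.1.1.1 - x.1.1.2 + x.1.2 - x.2, x.1.1.1 - x.1.1.2 - x.1.2 + x.2)))
    => [[[[x y] z] s]|[[[a b] c] d]].
    move=> [[/= h1 h2 h3 e] h4].
    move: (sqr_mod4 x) (sqr_mod4 y) (sqr_mod4 z) (sqr_mod4 s) => x4 y4 z4 s4.
    have y0 : (y %% 2)%Z = 0 by lia.
    have ea : 4 * ((x - 1 + y + z + s) %/ 4)%Z + 1 = x + y + z + s by lia.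
    have eb : 4 * ((x - 1 + y - z - s) %/ 4)%Z + 1 = x + y - z - s by lia.
    have ec : 4 * ((x - 1 - y + z - s) %/ 4)%Z + 1 = x - y + z - s by lia.
    have ed : 4 * ((x - 1 - y - z + s) %/ 4)%Z + 1 = x - y - z + s by lia.
    split=> //=; first by rewrite /odd_squares4/= ea eb ec ed; lia.
    by congr (_, _, _, _); lia.
  rewrite /odd_squares4/= => e; set x := 1 + _ + _ + _ + _; set y := a + b - c - d.
  set z := a - b + c - d; set s := a - b - c + d.
  have e' : x * x + y * y + z * z + s * s = n by rewrite /x /y /z /s; lia.
  move: (sqr_mod4 x) (sqr_mod4 y) (sqr_mod4 z) (sqr_mod4 s) => x4 y4 z4 s4.
  split; last by rewrite /x /y /z /s; congr (_, _, _, _); lia.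
  split=> /=; last by rewrite /x /y /z /s; lia.
  have ey : y = x - 1 - 2 * (c + d) by rewrite /x /y; lia.
  have ez : z = x - 1 - 2 * (b + d) by rewrite /x /z; lia.
  have es : s = x - 1 - 2 * (b + c) by rewrite /x /s; lia.
  by clearbody x y z s; split=> /=; lia.
- exact: finite_mixed4.
- move=> -[[[x y] z] s] [/= h1 h2 h3 e].
  move: (sqr_mod4 x) (sqr_mod4 y) (sqr_mod4 z) (sqr_mod4 s) => x4 y4 z4 s4.
  by split=> /=; [split=> /=; lia | rewrite opprK | | lia].
Qed.

(* [(y + x, y - x, z + s, z - s)] are odd with sum of squares [4 * k]. *)
Lemma card_mixed4_2mod4 k : (k %% 2)%Z = 1 ->
  \sum_(x \in mixed4 (2 * k)) (1 : int) = 4 * sigma k.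
Proof.
move=> k1; rewrite -tau4E//.
(* [C1] and [C2] normalise the signs of [(x, y)] and of [(z, s)], whence the factor 4. As [x] and
   [s] are even, [y - x] and [z - s] are then 1 mod 4 as well. *)
pose C1 : set (int * int * int * int) := [set x | ((x.1.1.2 + x.1.1.1) %% 4)%Z = 1].
pose C2 : set (int * int * int * int) := [set x | ((x.1.2 + x.2) %% 4)%Z = 1].
have odd x y z s : mixed4 (2 * k) (x, y, z, s) ->
    [/\ (x %% 2)%Z = 0, (y %% 2)%Z = 1, (z %% 2)%Z = 1 & (s %% 2)%Z = 0].
  move=> [/= h1 h2 h3 e].
  move: (sqr_mod4 x) (sqr_mod4 y) (sqr_mod4 z) (sqr_mod4 s) => x4 y4 z4 s4.
  by split; lia.
have fM := finite_mixed4 (2 * k).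
rewrite (@fsum_involution _ _ C1 _ (fun x => (- x.1.1.1, - x.1.1.2, x.1.2, x.2)))//; last first.
  move=> -[[[x y] z] s] h; have [x0 y1 z1 s0] := odd _ _ _ _ h; case: h => [/= h1 h2 h3 e].
  by split=> /=; [split=> /=; lia | rewrite !opprK | | rewrite /C1/=; lia].
rewrite (@fsum_involution _ _ C2 _ (fun x => (x.1.1.1, x.1.1.2, - x.1.2, - x.2)))//; last 2 first.
- by apply: sub_finite_set fM => x [].
- move=> -[[[x y] z] s] [h hC]; have [x0 y1 z1 s0] := odd _ _ _ _ h; case: h => [/= h1 h2 h3 e].
  by split=> /=; [split=> //; split=> /=; lia | rewrite !opprK | | rewrite /C2/=; lia].
suff -> : \sum_(i \in [set i | [set i0 | mixed4 (2 * k) i0 /\ C1 i0] i /\ C2 i]) (1 : int)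
        = tau4 k by lia.
apply: (@fsum_bij _ _ _ _ _ _
    (fun x => (((x.1.1.2 + x.1.1.1) %/ 4)%Z, ((x.1.1.2 - x.1.1.1) %/ 4)%Z,
               ((x.1.2 + x.2) %/ 4)%Z, ((x.1.2 - x.2) %/ 4)%Z))
    (fun x => (2 * x.1.1.1 - 2 * x.1.1.2, 2 * x.1.1.1 + 2 * x.1.1.2 + 1,
       2 * x.1.2 + 2 * x.2 + 1, 2 * x.1.2 - 2 * x.2)))
    => [[[[x y] z] s]|[[[a b] c] d]].
  move=> [[h c1] c2]; have [x0 y1 z1 s0] := odd _ _ _ _ h.
  case: h c1 c2 => [/= h1 h2 h3 e]; rewrite /C1 /C2 /= => c1 c2.
  have ea : 4 * ((y + x) %/ 4)%Z + 1 = y + x by lia.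
  have eb : 4 * ((y - x) %/ 4)%Z + 1 = y - x by lia.
  have ec : 4 * ((z + s) %/ 4)%Z + 1 = z + s by lia.
  have ed : 4 * ((z - s) %/ 4)%Z + 1 = z - s by lia.
  split=> //=; first by rewrite /odd_squares4/= ea eb ec ed; lia.
  by congr (_, _, _, _); lia.
rewrite /odd_squares4/= => e; split; last by congr (_, _, _, _); lia.
by split; [split; [split=> /=; lia | rewrite /C1/=; lia] | rewrite /C2/=; lia].
Qed.

(** * The class number relation *)

Lemma le_mull (a b : int) : 0 < a -> 0 <= b -> b <= a * b.
Proof. by nia. Qed.

Lemma eq0_or_le_mulr (a b : int) : 0 < a -> 0 <= b -> b = 0 \/ a <= a * b.
Proof. by nia. Qed.

(* Twice the Heaviside function: the boundary points of a cone are counted half. *)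
Definition hv (x : int) : int := if 0 < x then 2 else if x == 0 then 1 else 0.

Variant hv_spec (x : int) : int -> Type :=
  | HvPos of 0 < x : hv_spec x 2
  | HvZero of x = 0 : hv_spec x 1
  | HvNeg of x < 0 : hv_spec x 0.

Lemma hvP x : hv_spec x (hv x).
Proof. by rewrite /hv; case: (ltrgtP 0 x) => h; constructor. Qed.

Lemma hv_double x : hv (2 * x) = hv x.
Proof. by case: (hvP (2 * x)); case: (hvP x) => //; lia. Qed.

(* [(m, l, b)] stands for the positive forms [a X^2 + 2 b X Y + c Y^2] of determinant
   [N] with [a], [c] odd and [{a, c} = {m, m + l}], reduced in the sense that
   [|b| <= min(a, c)].  In the weight, [hv l] accounts for the two orderings of
   [a] and [c], and the second factor halves the forms with [|b| = m]. *)
Definition reduced_forms (N : int) : set (int * int * int) := [set x |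
  [/\ (x.1.1 %% 2)%Z = 1 /\ 0 < x.1.1, (x.1.2 %% 2)%Z = 0 /\ 0 <= x.1.2,
      - x.1.1 <= x.2 <= x.1.1 & x.1.1 * (x.1.1 + x.1.2) - x.2 * x.2 = N]].

Definition form_weight (m l b : int) : int := hv l * (hv (m + b) - hv (b - m)).

Definition class_count (N : int) : int := \sum_(x \in reduced_forms N) form_weight x.1.1 x.1.2 x.2.

Definition shifted_forms (n : int) : set (int * int * int * int) := [set x |
  (x.2 %% 2)%Z = 0 /\ reduced_forms (n - x.2 * x.2) x.1].

(** The forms of determinant 0, with [l = 0] and [b = m] or [b = - m], are infinitely many; they
    would need [n = s^2] with [s] even, which [n] mod 4 excludes. For all others the determinant
    bounds [m]. *)
Lemma finite_shifted_forms n : (n %% 4)%Z = 1 \/ (n %% 4)%Z = 2 -> finite_set (shifted_forms n).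
Proof.
move=> n12; apply: (@finite_box4 n) => -[[[m l] b] s] [/= s0 [/= [m1 m0] [l1 l0] bm e]].
have ss : 0 <= s * s by rewrite -expr2 sqr_ge0.
have := sqr_mod4 s => s4.
have ml : l <= m * l := le_mull m0 l0.
have mb : 0 <= (m - b) * (m + b) by rewrite mulr_ge0//; lia.
have mn : m <= n.
  have [lz|lz] := eq0_or_le_mulr m0 l0.
    have [eb|[eb|[b1 b2]]] : m = b \/ m = - b \/ 1 <= m - b /\ 1 <= m + b by lia.
    - by subst l b; lia.
    - by subst l m; lia.
    - have : 0 <= (m - b - 1) * (m + b - 1) by rewrite mulr_ge0//; lia.
      lia.
  lia.
by split; [lia | lia | lia | apply: sqr_le_itv; lia].
Qed.

(* In [shifted_forms_pos], the last component is [u = s - b] instead of [s], and the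
   bound [b <= m] is dropped because the weight vanishes for [b > m]. *)
Definition shifted_forms_pos (n : int) : set (int * int * int * int) := [set x |
  [/\ (x.1.1.1 %% 2)%Z = 1 /\ 0 < x.1.1.1, (x.1.1.2 %% 2)%Z = 0 /\ 0 <= x.1.1.2,
      - x.1.1.1 <= x.1.2, 0 < x.2 /\ ((x.1.2 + x.2) %% 2)%Z = 0 &
      x.1.1.1 * (x.1.1.1 + x.1.1.2) + x.2 * x.2 + 2 * x.2 * x.1.2 = n]].

Lemma finite_shifted_forms_pos n : (n %% 4)%Z = 1 \/ (n %% 4)%Z = 2 ->
  finite_set (shifted_forms_pos n).
Proof.
move=> n12; apply: (@finite_box4 (3 * `|n|)) => -[[[m l] b] u]
  [/= [m1 m0] [l1 l0] bm [u0 bu] e].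
have s0 : 0 <= (m - u) * (m - u) by rewrite -expr2 sqr_ge0.
have := sqr_mod4 (m - u) => s4.
have ml : l <= m * l := le_mull m0 l0.
have bm0 : 0 <= b + m by lia.
have ub := le_mull u0 bm0.
have [l0'|ml'] := eq0_or_le_mulr m0 l0.
  have [eb|bz] := eq0_or_le_mulr u0 bm0.
    have {}eb : b = - m by lia.
    by subst l b; lia.
  have : - n <= m - u <= n by apply: sqr_le_itv; lia.
  by split; lia.
have : - n <= m - u <= n by apply: sqr_le_itv; lia.
by split; lia.
Qed.

(** The points of [shifted_forms] with [s = b]. The bounds on [b] are strict because [b] is even and
    [m] odd. *)
Definition shifted_forms_diag (n : int) : set (int * int * int) := [set x |
  [/\ (x.1.1 %% 2)%Z = 1 /\ 0 < x.1.1, (x.1.2 %% 2)%Z = 0 /\ 0 <= x.1.2,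
      - x.1.1 < x.2 < x.1.1, (x.2 %% 2)%Z = 0 & x.1.1 * (x.1.1 + x.1.2) = n]].

(** The points with [s <> b] are paired by [(b, s) |-> (- b, - s)], which preserves the weight; the
    half with [s > b] is [shifted_forms_pos]. *)
Lemma shifted_forms_split n : (n %% 4)%Z = 1 \/ (n %% 4)%Z = 2 ->
  \sum_(x \in shifted_forms n) form_weight x.1.1.1 x.1.1.2 x.1.2 =
  \sum_(x \in shifted_forms_diag n) (2 * hv x.1.2) +
  2 * \sum_(x \in shifted_forms_pos n) form_weight x.1.1.1 x.1.1.2 x.1.2.
Proof.
move=> n12; have fK := finite_shifted_forms n12.
rewrite (fsum_split [set x | x.2 = x.1.2])//; congr (_ + _).
  apply: (@fsum_bij _ _ _ _ _ _ (fun x => x.1) (fun x => (x, x.2)))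
    => [[[[m l] b] s]|[[m l] b]].
    move=> [[/= s0 [/= m1 l1 bm e]] sb]; subst s; split=> //=; first by split=> //=; lia.
    by rewrite /form_weight; case: (hvP (m + b)); case: (hvP (b - m)) => *; lia.
  by move=> [/= m1 l1 bm b0 e]; split=> //; split=> //; split=> //; split=> //=; lia.
rewrite (@fsum_involution _ _ [set x | x.1.2 < x.2] _
  (fun x => (x.1.1, - x.1.2, - x.2))).
- congr (_ * _).
  transitivity (\sum_(x \in [set x | shifted_forms_pos n x /\ x.1.2 <= x.1.1.1])
     form_weight x.1.1.1 x.1.1.2 x.1.2).
    apply: (@fsum_bij _ _ _ _ _ _ (fun x => (x.1, x.2 - x.1.2)) (fun x => (x.1, x.2 + x.1.2)))
      => [[[[m l] b] s]|[[[m l] b] u]] /=.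
      move=> [[[/= s0 [/= [m1 m0] [l1 l0] bm e]] sb] lt]; split=> //=.
        by split; [split=> //=; lia | lia].
      by congr (_, _); lia.
    move=> [[/= m1 l1 bm [u0 ub] e] bm']; split; last by congr (_, _); lia.
    split; last by lia.
    split; last by lia.
    by split=> /=; [lia | split=> //=; lia].
  apply: fsum_widen => [[[[m l] b] u] [h _] //|[[[m l] b] u] h nh].
  case: h nh => [/= [m1 m0] [l1 l0] bm [u0 ub] e] nh.
  have bm' : m < b by rewrite ltNge; apply/negP => h; apply: nh.
  by rewrite /form_weight; case: (hvP (m + b)); case: (hvP (b - m)) => *; lia.
- by apply: sub_finite_set fK => x [].
- move=> -[[[m l] b] s] [[/= s0 [/= m1 l1 bm e]] sb]; split=> /=.
  + by split; [split=> /=; [lia | split=> //=; lia] | lia].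
  + by rewrite !opprK.
  + rewrite /form_weight; congr (_ * _).
    by case: (hvP (m + b)); case: (hvP (b - m));
      case: (hvP (m - b)); case: (hvP (- b - m)) => *; lia.
  + lia.
Qed.

(** Modulo 4 the left-hand side is [2 L] for [t] even and [2 L - 1] for [t] odd; with [L] even, [n]
    would be 0 or 3. *)
Lemma odd_of_eq n m L t j : (n %% 4)%Z = 1 \/ (n %% 4)%Z = 2 ->
  (m %% 2)%Z = 1 -> ((j - t) %% 2)%Z = 0 ->
  t * t + 2 * (m * L - t * j) = n -> (L %% 2)%Z = 1.
Proof.
move=> n12 m1 jt e.
have [m' em] : exists m', m = 2 * m' + 1 by exists (m %/ 2)%Z; lia.
have [t' et] : exists t', t = 2 * t' + (t %% 2)%Z by exists (t %/ 2)%Z; lia.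
have [j' ej] : exists j', j = 2 * j' + (t %% 2)%Z by exists ((j - (t %% 2)%Z) %/ 2)%Z; lia.
have [L' eL] : exists L', L = 2 * L' + (L %% 2)%Z by exists (L %/ 2)%Z; lia.
have hL : (L %% 2)%Z = 0 \/ (L %% 2)%Z = 1 by lia.
case: hL => // hL; rewrite hL in eL.
have ht : (t %% 2)%Z = 0 \/ (t %% 2)%Z = 1 by lia.
by case: ht => ht; rewrite ht in et ej; subst m t j L; lia.
Qed.

(* The weight of [b] is that of [b >= - m] minus that of [b >= m].  In the first part
   put [t = m - u], [j = b + m], [L = l / 2 + j], in the second one [t = m + u],
   [j = b - m], [L = l / 2 - j]. *)
Definition Bminus (n : int) : set (int * int * int * int) := [set x |
  let: (t, m, L, j) := x in
  [/\ (m %% 2)%Z = 1 /\ (L %% 2)%Z = 1, ((j - t) %% 2)%Z = 0, 0 < m /\ t < m, 0 <= j <= L &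
      t * t + 2 * (m * L - t * j) = n]].

Definition Bplus (n : int) : set (int * int * int * int) := [set x |
  let: (t, m, L, j) := x in
  [/\ (m %% 2)%Z = 1 /\ (L %% 2)%Z = 1, ((j - t) %% 2)%Z = 0, 0 < m < t, 0 <= j /\ - j <= L &
      t * t + 2 * (m * L + t * j) = n]].

Lemma finite_Bminus n : finite_set (Bminus n).
Proof.
apply: (@finite_box4 (4 * `|n|)) => -[[[t m] L] j] [/= [m1 L1] jt [m0 tm] jL e].
have tt : 0 <= t * t by rewrite -expr2 sqr_ge0.
have mt : 0 < m - t by lia.
have j0 : 0 <= j by lia.
have Lj : 0 <= L - j by lia.
have h3 := le_mull mt j0.
have h4 := le_mull m0 Lj.
have tn : - n <= t <= n by apply: sqr_le_itv; lia.
have [?|?] := eq0_or_le_mulr m0 Lj; last by split; lia.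
by have [?|?] := eq0_or_le_mulr mt j0; split; lia.
Qed.

Lemma finite_Bplus n : finite_set (Bplus n).
Proof.
apply: (@finite_box4 (4 * `|n|)) => -[[[t m] L] j] [/= [m1 L1] jt mt [j0 jL] e].
have t0 : 0 < t by lia.
have mt' : 0 < t - m by lia.
have m0 : 0 < m by lia.
have Lj : 0 <= L + j by lia.
have tt := le_mull t0 (ltW t0).
have h1 := le_mull mt' j0.
have h2 := le_mull m0 Lj.
by split; lia.
Qed.

Lemma shifted_forms_pos_sum n : (n %% 4)%Z = 1 \/ (n %% 4)%Z = 2 ->
  \sum_(x \in shifted_forms_pos n) form_weight x.1.1.1 x.1.1.2 x.1.2 =
  \sum_(x \in Bminus n) (hv x.2 * hv (x.1.2 - x.2)) -
  \sum_(x \in Bplus n) (hv x.2 * hv (x.1.2 + x.2)).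
Proof.
move=> n12; have fK := finite_shifted_forms_pos n12.
transitivity (\sum_(x \in shifted_forms_pos n) (hv x.1.1.2 * hv (x.1.1.1 + x.1.2)) -
              \sum_(x \in shifted_forms_pos n) (hv x.1.1.2 * hv (x.1.2 - x.1.1.1))).
  by rewrite -(fsumB _ _ fK); apply: eq_fsbigr => x _; rewrite /form_weight mulrBr.
congr (_ - _).
  apply: (@fsum_bij _ _ _ _ _ _
      (fun x => (x.1.1.1 - x.2, x.1.1.1, (x.1.1.2 %/ 2)%Z + (x.1.2 + x.1.1.1), x.1.2 + x.1.1.1))
      (fun x => (x.1.1.2, 2 * (x.1.2 - x.2), x.2 - x.1.1.2, x.1.1.2 - x.1.1.1)))
    => [[[[m l] b] u]|[[[t m] L] j]].
    move=> [/= [m1 m0] [l1 l0] bm [u0 bu] e].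
    have [l' el] : exists l', l = 2 * l' by exists (l %/ 2)%Z; lia.
    have -> : (l %/ 2)%Z = l' by lia.
    have e' : (m - u) * (m - u) + 2 * (m * (l' + (b + m)) - (m - u) * (b + m)) = n.
      by subst l; lia.
    split=> /=.
    + by split=> //=; [split=> //; apply: odd_of_eq e' => //; lia | lia | lia | lia].
    + by congr (_, _, _, _); lia.
    + by rewrite el hv_double mulrC addrK [m + b]addrC.
  move=> [/= [m1 L1] jt [m0 tm] jL e]; split; first by split=> /=; lia.
  by congr (_, _, _, _); lia.
transitivity (\sum_(x \in [set x | shifted_forms_pos n x /\ x.1.1.1 <= x.1.2])
     (hv x.1.1.2 * hv (x.1.2 - x.1.1.1))).
  apply/esym/fsum_widen => [x [] //|[[[m l] b] u] h nh /=].
  have bm : b < m by rewrite ltNge; apply/negP => h'; apply: nh.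
  by case: (hvP (b - m)) => ?; lia.
apply: (@fsum_bij _ _ _ _ _ _
    (fun x => (x.1.1.1 + x.2, x.1.1.1, (x.1.1.2 %/ 2)%Z - (x.1.2 - x.1.1.1), x.1.2 - x.1.1.1))
    (fun x => (x.1.1.2, 2 * (x.1.2 + x.2), x.2 + x.1.1.2, x.1.1.1 - x.1.1.2)))
  => [[[[m l] b] u]|[[[t m] L] j]].
  move=> [[/= [m1 m0] [l1 l0] bm [u0 bu] e] /= bm'].
  have [l' el] : exists l', l = 2 * l' by exists (l %/ 2)%Z; lia.
  have -> : (l %/ 2)%Z = l' by lia.
  have e' : (m + u) * (m + u) + 2 * (m * (l' - (b - m)) - (m + u) * (- (b - m))) = n.
    by subst l; lia.
  split=> /=.
  + by split=> //=; [split=> //; apply: odd_of_eq e' => //; lia | lia | lia | lia | lia].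
  + by congr (_, _, _, _); lia.
  + by rewrite el hv_double mulrC subrK.
move=> [/= [m1 L1] jt mt [j0 jL] e]; split; first by split=> /=; [split=> /=; lia | lia].
by congr (_, _, _, _); lia.
Qed.

(** The common domain to which the parts [t < 0] and [t > 0] of [Bminus] and the part [L > 0] of
    [Bplus] are carried. The points that end up with [L < 0] are collected in [Yset]. *)
Definition Zplus (n : int) : set (int * int * int * int) := [set x |
  let: (t, m, L, J) := x in
  [/\ (m %% 2)%Z = 1 /\ (L %% 2)%Z = 1, ((J - t) %% 2)%Z = 0, 0 < t /\ 0 < m, 0 < L /\ 0 <= J &
      t * t + 2 * (m * L + t * J) = n]].

Definition Yset (n : int) : set (int * int * int * int) := [set x |
  let: (t, m, L, J) := x in
  [/\ (m %% 2)%Z = 1 /\ (L %% 2)%Z = 1, ((J - t) %% 2)%Z = 0, 0 < m < t, L < 0 /\ - L <= J &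
      t * t + 2 * (m * L + t * J) = n]].

Definition Bzero (n : int) : set (int * int * int) := [set x |
  let: (m, L, j) := x in
  [/\ (m %% 2)%Z = 1 /\ (L %% 2)%Z = 1, (j %% 2)%Z = 0, 0 < m, 0 <= j <= L & 2 * (m * L) = n]].

Lemma finite_Zplus n : finite_set (Zplus n).
Proof.
apply: (@finite_box4 n) => -[[[t m] L] J] [/= [m1 L1] Jt [t0 m0] [L0 J0] e].
have h1 := le_mull t0 (ltW t0).
have h2 := le_mull m0 (ltW L0).
have h3 := le_mull L0 (ltW m0).
have h4 := le_mull t0 J0.
have h5 : 0 <= t * J by rewrite mulr_ge0// ltW.
by split; lia.
Qed.

Lemma finite_Yset n : finite_set (Yset n).
Proof.
apply: (@finite_box4 n) => -[[[t m] L] J] [/= [m1 L1] Jt mt [L0 JL] e].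
have t0 : 0 < t by lia.
have J0 : 0 <= J + L by lia.
have tm : 0 < t - m by lia.
have L0' : 0 <= - L by lia.
have h1 := le_mull t0 (ltW t0).
have h2 := le_mull t0 J0.
have h3 := le_mull tm L0'.
by split; lia.
Qed.

Lemma finite_sub_Bminus n (A : set (int * int * int * int)) :
  finite_set [set x | Bminus n x /\ A x].
Proof. by apply: sub_finite_set (finite_Bminus n) => x []. Qed.

Lemma finite_sub_Zplus n (A : set (int * int * int * int)) :
  finite_set [set x | Zplus n x /\ A x].
Proof. by apply: sub_finite_set (finite_Zplus n) => x []. Qed.

Lemma Bminus_zero n :
  \sum_(x \in [set x | Bminus n x /\ x.1.1.1 = 0]) (hv x.2 * hv (x.1.2 - x.2)) =
  \sum_(x \in Bzero n) (hv x.2 * hv (x.1.2 - x.2)).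
Proof.
apply: (@fsum_bij _ _ _ _ _ _ (fun x => (x.1.1.2, x.1.2, x.2))
  (fun x => (0, x.1.1, x.1.2, x.2))) => [[[[t m] L] j]|[[m L] j]].
  move=> [[/= mL jt [m0 tm] jL e] t0]; subst t; split=> //=.
  by split=> //; lia.
by move=> [/= mL j0 m0 jL e]; split=> //; split=> //=; split=> //; lia.
Qed.

Lemma Bminus_neg n :
  \sum_(x \in [set x | Bminus n x /\ x.1.1.1 < 0]) (hv x.2 * hv (x.1.2 - x.2)) =
  \sum_(x \in Zplus n) (hv x.2 * hv (x.1.2 - x.2)).
Proof.
transitivity (\sum_(x \in [set x | Zplus n x /\ x.2 <= x.1.2]) (hv x.2 * hv (x.1.2 - x.2))).
  apply: (@fsum_bij _ _ _ _ _ _ (fun x => (- x.1.1.1, x.1.1.2, x.1.2, x.2))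
    (fun x => (- x.1.1.1, x.1.1.2, x.1.2, x.2))) => -[[[t m] L] j].
    move=> [[/= mL jt [m0 tm] jL e] /= t0]; split=> //=; last by rewrite opprK.
    by split; [split; lia | lia].
  move=> [[/= mL jt [t0 m0] [L0 J0] e] /= jL]; split=> //=; last by rewrite opprK.
  by split; [split; lia | lia].
apply: fsum_widen => [x [] //|[[[t m] L] J] h nh /=].
have LJ : L < J by rewrite ltNge; apply/negP => h'; apply: nh.
by case: (hvP (L - J)); lia.
Qed.

Definition Bminus_shifted (n : int) : set (int * int * int * int) := [set x |
  let: (t, m, L, J) := x in
  [/\ (m %% 2)%Z = 1 /\ (L %% 2)%Z = 1, ((J - t) %% 2)%Z = 0, 0 < t /\ - t < m,
      0 < L /\ L <= J <= 2 * L & t * t + 2 * (m * L + t * J) = n]].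

(* [(m, J) |-> (m - 2 t, J + 2 L)] preserves [m L + t J]; after this shift the
   points with [m < 0] are reflected to [Yset] by [(m, L) |-> (- m, - L)]. *)
Lemma Bminus_pos n :
  \sum_(x \in [set x | Bminus n x /\ 0 < x.1.1.1]) (hv x.2 * hv (x.1.2 - x.2)) =
  \sum_(x \in Zplus n) (hv (2 * x.1.2 - x.2) * hv (x.2 - x.1.2)) +
  \sum_(x \in Yset n) (hv (- 2 * x.1.2 - x.2) * hv (x.2 + x.1.2)).
Proof.
pose h (x : int * int * int * int) : int * int * int * int :=
  (x.1.1.1, x.1.1.2 - 2 * x.1.1.1, x.1.2, 2 * x.1.2 - x.2).
pose k (x : int * int * int * int) : int * int * int * int :=
  (x.1.1.1, x.1.1.2 + 2 * x.1.1.1, x.1.2, 2 * x.1.2 - x.2).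
rewrite (@fsum_bij _ _ _ (Bminus_shifted n) _
  (fun x => hv (2 * x.1.2 - x.2) * hv (x.2 - x.1.2)) h k); first last.
- move=> [[[t m] L] J] [/= mL jt [t0 tm] [L0 JL] e]; rewrite /h /k; split.
    by split=> //=; split=> //; lia.
  by congr (_, _, _, _) => /=; lia.
- move=> [[[t m] L] j] [[/= mL jt [m0 tm] jL e] /= t0]; rewrite /h /k; split=> /=.
  + by split; lia.
  + by congr (_, _, _, _); lia.
  + by congr (hv _ * hv _); lia.
have fS : finite_set (Bminus_shifted n).
  have -> : Bminus_shifted n = h @` [set x | Bminus n x /\ 0 < x.1.1.1].
    apply/seteqP; split=> [[[[t m] L] J]|_ [[[[t m] L] j] + <-]].
      move=> [/= mL jt [t0 tm] [L0 JL] e]; exists (k (t, m, L, J)); rewrite /h /k /=.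
        by split=> //; split; lia.
      by congr (_, _, _, _); lia.
    by move=> [[/= mL jt [m0 tm] jL e] /= t0]; split=> /=; lia.
  exact/finite_image/finite_sub_Bminus.
rewrite (fsum_split [set x | 0 < x.1.1.2])//; congr (_ + _).
  apply: fsum_widen => [[[[t m] L] J]|[[[t m] L] J]].
    by move=> [[/= mL jt [t0 tm] [L0 JL] e] /= m0]; split=> //=; split=> //; lia.
  move=> [/= mL jt [t0 m0] [L0 J0] e] nh.
  case: (hvP (2 * L - J)) => ?; case: (hvP (J - L)) => ? //;
    by case: nh; split=> //=; split=> //; lia.
transitivity (\sum_(x \in [set x | Yset n x /\ x.2 <= - 2 * x.1.2])
   (hv (- 2 * x.1.2 - x.2) * hv (x.2 + x.1.2))).
  apply: (@fsum_bij _ _ _ _ _ _ (fun x => (x.1.1.1, - x.1.1.2, - x.1.2, x.2))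
    (fun x => (x.1.1.1, - x.1.1.2, - x.1.2, x.2))) => -[[[t m] L] J].
    move=> [[/= mL jt [t0 tm] [L0 JL] e] /= m0]; split=> /=.
    + by split; [split; lia | lia].
    + by rewrite !opprK.
    + by congr (hv _ * hv _); lia.
  move=> [[/= mL jt mt [L0 JL] e] /= JL']; split; last by rewrite /= !opprK.
  by split=> /=; [split; lia | lia].
apply: fsum_widen => [x [] //|[[[t m] L] J] h' nh /=].
have LJ : - 2 * L < J by rewrite ltNge; apply/negP => h''; apply: nh.
by case: (hvP (- 2 * L - J)); lia.
Qed.

(** One of the two factors is always 2: [hv (L + J)] if [L > 0], and [hv J] if [L < 0], as then
    [J >= - L > 0]. The odd [L] is never 0. *)
Lemma Bplus_sum n :
  \sum_(x \in Bplus n) (hv x.2 * hv (x.1.2 + x.2)) =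
  2 * \sum_(x \in [set x | Zplus n x /\ x.1.1.2 < x.1.1.1]) hv x.2 +
  2 * \sum_(x \in Yset n) hv (x.2 + x.1.2).
Proof.
have fB := finite_Bplus n.
rewrite -!fsumZ (fsum_split [set x | 0 < x.1.2])//; congr (_ + _).
  apply: eq_fsum => -[[[t m] L] J].
    split=> [[[/= mL jt mt [J0 JL] e] /= L0]|[[/= mL jt [t0 m0] [L0 J0] e] /= mt]].
      by split=> /=; [split=> //; lia | lia].
    by split=> //=; split=> //; lia.
  move=> [[/= mL jt mt [J0 JL] e] /= L0].
  by case: (hvP (L + J)) => ?; case: (hvP J) => ?; lia.
apply: eq_fsum => -[[[t m] L] J].
  split=> [[[/= mL jt mt [J0 JL] e] /= L0]|[/= mL jt mt [L0 J0] e]].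
    by split=> /=; lia.
  by split=> /=; [split=> //; lia | lia].
move=> [[/= mL jt mt [J0 JL] e] /= L0]; rewrite [J + L]addrC.
by case: (hvP (L + J)) => ?; case: (hvP J) => ?; lia.
Qed.

(** The map [(m, J) |-> (m + 2 t, J - 2 L)] preserves [m L + t J] and sends the points with
    [2 L <= J], which carry all the weight, onto those with [2 t < m]. *)
Lemma Zplus_shift n :
  \sum_(x \in Zplus n) hv (x.2 - 2 * x.1.2) =
  \sum_(x \in [set x | Zplus n x /\ 2 * x.1.1.1 < x.1.1.2]) hv x.2.
Proof.
transitivity (\sum_(x \in [set x | Zplus n x /\ 2 * x.1.2 <= x.2]) hv (x.2 - 2 * x.1.2)).
  apply/esym/fsum_widen => [x [] //|[[[t m] L] J] h nh /=].
  have LJ : J < 2 * L by rewrite ltNge; apply/negP => h'; apply: nh.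
  by case: (hvP (J - 2 * L)); lia.
apply: (@fsum_bij _ _ _ _ _ _ (fun x => (x.1.1.1, x.1.1.2 + 2 * x.1.1.1, x.1.2, x.2 - 2 * x.1.2))
    (fun x => (x.1.1.1, x.1.1.2 - 2 * x.1.1.1, x.1.2, x.2 + 2 * x.1.2))) => -[[[t m] L] J].
  move=> [[/= mL jt [t0 m0] [L0 J0] e] /= LJ]; split=> //=.
    by split; [split; lia | lia].
  by congr (_, _, _, _); lia.
move=> [[/= mL jt [t0 m0] [L0 J0] e] /= LJ]; split; first by split=> /=; [split; lia | lia].
by congr (_, _, _, _) => /=; lia.
Qed.

(* For [L < 0], write [m L + t J = (2 t - m) (- L) + t (J + 2 L)]. *)
Lemma Yset_flip n :
  \sum_(x \in Yset n) hv (x.2 + 2 * x.1.2) =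
  \sum_(x \in [set x | Zplus n x /\ x.1.1.1 < x.1.1.2 < 2 * x.1.1.1]) hv x.2.
Proof.
transitivity (\sum_(x \in [set x | Yset n x /\ - 2 * x.1.2 <= x.2]) hv (x.2 + 2 * x.1.2)).
  apply/esym/fsum_widen => [x [] //|[[[t m] L] J] h nh /=].
  have LJ : J < - 2 * L by rewrite ltNge; apply/negP => h'; apply: nh.
  by case: (hvP (J + 2 * L)); lia.
apply: (@fsum_bij _ _ _ _ _ _ (fun x => (x.1.1.1, 2 * x.1.1.1 - x.1.1.2, - x.1.2, x.2 + 2 * x.1.2))
    (fun x => (x.1.1.1, 2 * x.1.1.1 - x.1.1.2, - x.1.2, x.2 + 2 * x.1.2))) => -[[[t m] L] J].
  move=> [[/= mL jt mt [L0 J0] e] /= LJ]; split=> //=.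
    by split; [split; lia | lia].
  by congr (_, _, _, _); lia.
move=> [[/= mL jt [t0 m0] [L0 J0] e] /= LJ]; split; first by split=> /=; [split; lia | lia].
by congr (_, _, _, _) => /=; lia.
Qed.

(** On [Zplus] the two weights coming from [Bminus] add up to [2 hv J - 2 hv (J - 2 L)], and the
    weight on [Yset] is a similar difference. After [Zplus_shift] and [Yset_flip] the negative terms
    are the parts [2 t < m], [t < m < 2 t] and, from [Bplus], [m < t] of the sum of [2 hv J] over
    [Zplus]; the part [m = t] survives. *)
Lemma Bminus_Bplus n :
  \sum_(x \in Bminus n) (hv x.2 * hv (x.1.2 - x.2)) -
  \sum_(x \in Bplus n) (hv x.2 * hv (x.1.2 + x.2)) =
  \sum_(x \in Bzero n) (hv x.2 * hv (x.1.2 - x.2)) +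
  2 * \sum_(x \in [set x | Zplus n x /\ x.1.1.2 = x.1.1.1]) hv x.2.
Proof.
have fB := finite_Bminus n; have fZ := finite_Zplus n; have fY := finite_Yset n.
rewrite (fsum_split [set x | x.1.1.1 = 0])// Bminus_zero -addrA; congr (_ + _).
rewrite (fsum_split [set x | 0 < x.1.1.1]); last exact: finite_sub_Bminus.
set sp := \sum_(x \in _) _; set sn := \sum_(x \in _) _.
have -> : sp = \sum_(x \in [set x | Bminus n x /\ 0 < x.1.1.1]) (hv x.2 * hv (x.1.2 - x.2)).
  apply: eq_fsum => // -[[[t m] L] j]; split=> [[[h _] t0]|[h /= t0]] //.
  by split=> //; split=> //= t0'; lia.
have -> : sn = \sum_(x \in [set x | Bminus n x /\ x.1.1.1 < 0]) (hv x.2 * hv (x.1.2 - x.2)).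
  apply: eq_fsum => // -[[[t m] L] j]; split=> [[[h /= t0] /= t0']|[h /= t0]] //.
    by split=> //=; lia.
  by split=> //; [split=> //= |] => /= t0'; lia.
rewrite Bminus_pos Bminus_neg Bplus_sum.
have eZ : \sum_(x \in Zplus n) (hv x.2 * hv (x.1.2 - x.2)) +
    \sum_(x \in Zplus n) (hv (2 * x.1.2 - x.2) * hv (x.2 - x.1.2)) =
    2 * \sum_(x \in Zplus n) hv x.2 - 2 * \sum_(x \in Zplus n) hv (x.2 - 2 * x.1.2).
  rewrite -fsumD// -!fsumZ -fsumB//.
  apply: eq_fsum => // -[[[t m] L] J] [/= mL jt [t0 m0] [L0 J0] e].
  case: (hvP J) => ?; case: (hvP (L - J)) => ?; case: (hvP (2 * L - J)) => ?;
    case: (hvP (J - L)) => ?; case: (hvP (J - 2 * L)) => ?; lia.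
have eY : \sum_(x \in Yset n) (hv (- 2 * x.1.2 - x.2) * hv (x.2 + x.1.2)) =
    2 * \sum_(x \in Yset n) hv (x.2 + x.1.2) - 2 * \sum_(x \in Yset n) hv (x.2 + 2 * x.1.2).
  rewrite -!fsumZ -fsumB//.
  apply: eq_fsum => // -[[[t m] L] J] [/= mL jt mt [L0 J0] e].
  by case: (hvP (- 2 * L - J)) => ?; case: (hvP (J + L)) => ?;
    case: (hvP (J + 2 * L)) => ?; lia.
(* The case [m = 2 t] is absent because [m] is odd. *)
have eP : \sum_(x \in Zplus n) hv x.2 =
    \sum_(x \in [set x | Zplus n x /\ x.1.1.2 = x.1.1.1]) hv x.2 +
    (\sum_(x \in [set x | Zplus n x /\ x.1.1.2 < x.1.1.1]) hv x.2 +
    (\sum_(x \in [set x | Zplus n x /\ 2 * x.1.1.1 < x.1.1.2]) hv x.2 +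
     \sum_(x \in [set x | Zplus n x /\ x.1.1.1 < x.1.1.2 < 2 * x.1.1.1]) hv x.2)).
  rewrite (fsum_split [set x | x.1.1.2 = x.1.1.1])//; congr (_ + _).
  rewrite (fsum_split [set x | x.1.1.2 < x.1.1.1]); last exact: finite_sub_Zplus.
  congr (_ + _).
    apply: eq_fsum => // -[[[t m] L] j]; split=> [[[h _] t0]|[h /= t0]] //.
    by split=> //; split=> //= t0'; lia.
  rewrite (fsum_split [set x | 2 * x.1.1.1 < x.1.1.2]); last first.
    by apply: sub_finite_set (finite_Zplus n) => x [[]].
  congr (_ + _).
    apply: eq_fsum => // -[[[t m] L] j]; split=> [[[[h _] _] t0]|[h /= t0]] //.
    have t00 : 0 < t by case: h => /= _ _ [].
    by split=> //; split; [split=> //= |] => /= t0'; lia.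
  apply: eq_fsum => // -[[[t m] L] j]; split=> [[[[h /= h1] /= h2] /= h3]|[h /= t0]] //.
    by split=> //=; case: h => /= -[? ?] _ _ _ _; lia.
  by split=> //; [split=> //; [split=> //= |] |] => /= t0'; lia.
move: eZ eY eP; rewrite Zplus_shift Yset_flip.
lia.
Qed.

(** * Evaluation of the remaining terms as divisor sums *)

Lemma modz2_mul (a b : int) :
  ((a * b) %% 2)%Z = 1 <-> (a %% 2)%Z = 1 /\ (b %% 2)%Z = 1.
Proof.
have ha : (a %% 2)%Z = 0 \/ (a %% 2)%Z = 1 by lia.
have hb : (b %% 2)%Z = 0 \/ (b %% 2)%Z = 1 by lia.
have [a' ea] : exists a', a = 2 * a' + (a %% 2)%Z by exists (a %/ 2)%Z; lia.
have [b' eb] : exists b', b = 2 * b' + (b %% 2)%Z by exists (b %/ 2)%Z; lia.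
by case: ha ea => -> ea; case: hb eb => -> eb; subst a b; split; lia.
Qed.

(** Complementary divisors [d <= D] of an odd [n], encoded as [(d, D - d)] to match [(m, l)]. *)
Definition divpairs (n : int) : set (int * int) := [set x |
  [/\ 0 < x.1 /\ (x.1 %% 2)%Z = 1, 0 <= x.2 /\ (x.2 %% 2)%Z = 0 & x.1 * (x.1 + x.2) = n]].

Lemma finite_divpairs n : finite_set (divpairs n).
Proof.
apply: (@finite_box2 n) => -[d l] [/= [d0 _] [l0 _] e].
have h1 := le_mull d0 (ltW d0).
have h2 := le_mull d0 l0.
have h3 : 0 <= d * l by rewrite mulr_ge0// ltW.
by split; lia.
Qed.

(** Two divisors [d < D] contribute [d + D = 2 d + l], and [d = D] contributes [d] once; [hv l]
    covers both cases. *)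
Lemma sigma_divpairs n : (n %% 2)%Z = 1 ->
  sigma n = \sum_(x \in divpairs n) (hv x.2 * x.1 + x.2).
Proof.
move=> n1; have fD := finite_divisor_pairs n; have fP := finite_divpairs n.
rewrite /sigma (fsum_split [set x | x.1 <= x.2])//.
have odd d D : d * D = n -> (d %% 2)%Z = 1 /\ (D %% 2)%Z = 1.
  by move=> e; apply/modz2_mul; rewrite e.
have -> : \sum_(x \in divpairs n) (hv x.2 * x.1 + x.2) =
   \sum_(x \in divpairs n) (x.1 + (if 0 < x.2 then x.1 + x.2 else 0)).
  apply: eq_fsum => // -[d l] [/= _ [l0 _] _].
  by case: (hvP l) => *; case: ifP => *; lia.
rewrite fsumD//; congr (_ + _).
  apply: (@fsum_bij _ _ _ _ _ _ (fun x => (x.1, x.2 - x.1)) (fun x => (x.1, x.1 + x.2)))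
    => [[d D]|[d l]].
    move=> [[/= d0 D0 e] /= dD]; have [d1 D1] := odd _ _ e; split=> //=.
      by split=> /=; [split | split; lia | lia].
    by congr (_, _); lia.
  move=> [/= [d0 d1] [l0 l1] e]; split; last by congr (_, _) => /=; lia.
  by split=> /=; [split=> //; lia | lia].
transitivity (\sum_(x \in [set x | divpairs n x /\ 0 < x.2]) (x.1 + x.2)).
  apply: (@fsum_bij _ _ _ _ _ _ (fun x => (x.2, x.1 - x.2)) (fun x => (x.1 + x.2, x.1)))
    => [[d D]|[d l]].
    move=> [[/= d0 D0 e] /= dD]; have [d1 D1] := odd _ _ e; split=> /=.
    + by split=> /=; [split=> /=; [split | split; lia | lia] | lia].
    + by congr (_, _); lia.
    + lia.
  move=> [[/= [d0 d1] [l0 l1] e] /= l0']; split; last by congr (_, _) => /=; lia.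
  by split=> /=; [split=> //=; lia | lia].
apply: fsum_widen => [[d l] [h /= l0]|[d l] h nh /=]; first by rewrite l0.
by case: ifP => // l0; case: nh.
Qed.

Lemma card_even_itv (m : int) : 0 < m -> (m %% 2)%Z = 1 ->
  \sum_(b \in [set b : int | - m < b < m /\ (b %% 2)%Z = 0]) (1 : int) = m.
Proof.
move=> m0 m1; rewrite -[RHS](@fsum_itv m) ?ltW//.
apply: (@fsum_bij _ _ _ _ _ _ (fun b : int => ((b + m - 1) %/ 2)%Z) (fun i => 2 * i - m + 1))
  => i /=.
  by move=> [im i0]; split=> //; lia.
by move=> im; split; [split; lia | lia].
Qed.

Lemma shifted_forms_diag_sum n :
  \sum_(x \in shifted_forms_diag n) (2 * hv x.1.2) = \sum_(x \in divpairs n) (2 * hv x.2 * x.1).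
Proof.
have fD : finite_set (shifted_forms_diag n).
  apply: (@finite_box3 n) => -[[m l] b] [/= [m1 m0] [l1 l0] bm b0 e].
  have h1 := le_mull m0 (ltW m0).
  have h2 := le_mull m0 l0.
  have h3 : 0 <= m * l by rewrite mulr_ge0// ltW.
  by split; lia.
rewrite (@fsum_fiber _ _ _ (divpairs n) (fun x => x.1))//.
- apply: eq_fsum => // -[m l] [/= [m0 m1] [l0 l1] e].
  rewrite -[in RHS](card_even_itv m0 m1) -fsumZ.
  apply: (@fsum_bij _ _ _ _ _ _ (fun x => x.2) (fun b => (m, l, b))) => [[[m' l'] b]|b].
    by move=> [[/= _ _ bm b0 _] [em el]]; subst m' l'; split; rewrite ?mulr1.
  by move=> /= [bm b0]; split=> //; split=> //; split.
- exact: finite_divpairs.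
- by move=> [[m l] b] [/= [m1 m0] [l1 l0] bm b0 e]; split.
Qed.

(** For [m = t] the equation reads [t (t + l) = n] with [l = 2 (L + J)]. Here [J] is odd, so each
    point has weight 4, and [L] takes the [l / 4] odd values below [l / 2]. *)
Lemma Zplus_diag_sum n : (n %% 4)%Z = 1 ->
  \sum_(x \in [set x | Zplus n x /\ x.1.1.2 = x.1.1.1]) (2 * hv x.2) =
  \sum_(x \in divpairs n) x.2.
Proof.
move=> n1; have fZ := @finite_sub_Zplus n [set x | x.1.1.2 = x.1.1.1].
rewrite (@fsum_fiber _ _ _ (divpairs n) (fun x => (x.1.1.1, 2 * (x.1.2 + x.2))))//.
- apply: eq_fsum => // -[d l] [/= [d0 d1] [l0 l1] e].
  have l4 : (l %% 4)%Z = 0.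
    have [d' ed] : exists d', d = 2 * d' + 1 by exists (d %/ 2)%Z; lia.
    have [l' el] : exists l', l = 2 * l' by exists (l %/ 2)%Z; lia.
    by subst d l; lia.
  rewrite -[in RHS](_ : 4 * (l %/ 4)%Z = l); last lia.
  rewrite -[X in 4 * X]fsum_itv -?fsumZ; last lia.
  apply: (@fsum_bij _ _ _ _ _ _ (fun x => ((x.1.2 - 1) %/ 2)%Z)
    (fun i => (d, d, 2 * i + 1, (l %/ 2)%Z - 2 * i - 1))) => [[[[t m] L] J]|i].
    move=> [[[/= [m1 L1] jt [t0 m0] [L0 J0] e'] /= mt] [/= td lLJ]]; subst m d l; split=> /=.
    + by lia.
    + by congr (_, _, _, _); lia.
    + by case: (hvP J) => ?; lia.
  move=> /= il; split; last by lia.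
  split; last by congr (_, _); lia.
  split=> //; split=> /=; [split; lia | lia | lia | lia |].
  have [l' el] : exists l', l = 2 * l' by exists (l %/ 2)%Z; lia.
  have -> : (l %/ 2)%Z = l' by lia.
  by subst l; lia.
- exact: finite_divpairs.
- move=> [[[t m] L] J] [[/= [m1 L1] jt [t0 m0] [L0 J0] e] /= mt]; subst m.
  by split=> /=; [split | split; lia | lia].
Qed.

(** The term [j = 0] is 2, and each of the [(L - 1) / 2] positive even [j < L] gives 4; [j = L] is
    odd. *)
Lemma sum_even_hv (L : int) : 0 < L -> (L %% 2)%Z = 1 ->
  \sum_(j \in [set j : int | 0 <= j <= L /\ (j %% 2)%Z = 0]) (hv j * hv (L - j)) = 2 * L.
Proof.
move=> L0 L1.
rewrite (@fsbigD1 _ _ _ _ 0)/=; last by split; lia.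
  have -> : \sum_(j \in [set j : int | 0 <= j <= L /\ (j %% 2)%Z = 0] `\ 0) (hv j * hv (L - j)) =
      4 * \sum_(i \in [set i : int | 0 <= i < ((L - 1) %/ 2)%Z]) (1 : int).
    rewrite -fsumZ; apply: (@fsum_bij _ _ _ _ _ _ (fun j => (j %/ 2)%Z - 1)
      (fun i => 2 * i + 2)) => i /=.
      move=> [[iL i0] /eqP in0]; split; [lia | lia |].
      by case: (hvP i); case: (hvP (L - i)); lia.
    by move=> iL; split; [split; [split; lia | move=> /=; lia] | lia].
  rewrite fsum_itv; last lia.
  by rewrite subr0; case: (hvP 0) => //; case: (hvP L); lia.
by apply: (@finite_box1 L) => j /= [jL _]; lia.
Qed.

Lemma Bzero_sum k : (k %% 2)%Z = 1 ->
  \sum_(x \in Bzero (2 * k)) (hv x.2 * hv (x.1.2 - x.2)) = 2 * sigma k.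
Proof.
move=> k1; have fD := finite_divisor_pairs k.
have fB : finite_set (Bzero (2 * k)).
  apply: (@finite_box3 k) => -[[m L] j] [/= [m1 L1] j0 m0 jL e].
  have L0 : 0 < L by lia.
  have h1 := le_mull m0 (ltW L0).
  have h2 := le_mull L0 (ltW m0).
  by split; lia.
rewrite /sigma -fsumZ (@fsum_fiber _ _ _
  [set x : int * int | [/\ 0 < x.1, 0 < x.2 & x.1 * x.2 = k]] (fun x => (x.1.2, x.1.1)))//.
  apply: eq_fsum => // -[L m] [/= L0 m0 e].
  have [L1 m1] : (L %% 2)%Z = 1 /\ (m %% 2)%Z = 1 by apply/modz2_mul; rewrite e.
  rewrite -[RHS](sum_even_hv L0 L1).
  apply: (@fsum_bij _ _ _ _ _ _ (fun x => x.2) (fun j => (m, L, j))) => [[[m' L'] j]|j].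
    by move=> [[/= mL j0 m0' jL e'] [eL em]]; subst m' L'.
  by move=> /= [jL j0]; split=> //; split=> //; split=> //; lia.
by move=> [[m L] j] [/= [m1 L1] j0 m0 jL e]; split=> /=; lia.
Qed.

Lemma class_count_fiber n (D : set int) :
  (n %% 4)%Z = 1 \/ (n %% 4)%Z = 2 -> finite_set D ->
  (forall s, s * s <= n -> (s %% 2)%Z = 0 -> D s) -> (forall s, D s -> (s %% 2)%Z = 0) ->
  \sum_(s \in D) class_count (n - s * s) =
  \sum_(x \in shifted_forms n) form_weight x.1.1.1 x.1.1.2 x.1.2.
Proof.
move=> n12 fD sD Ds; apply/esym.
rewrite (@fsum_fiber _ _ _ D (fun x => x.2))//.
- apply: eq_fsum => // s Hs.
  apply: (@fsum_bij _ _ _ _ _ _ (fun x => x.1) (fun x => (x, s))) => [[x s']|x].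
    by move=> [[/= s0 h] ss]; subst s'.
  by move=> h; split=> //; split=> //; split=> //; exact: Ds.
- exact: finite_shifted_forms.
- move=> [[[m l] b] s] [/= s0 [/= [m1 m0] [l1 l0] bm e]]; apply: sD => //.
  have h1 : 0 <= m * l by rewrite mulr_ge0// ltW.
  have h2 : 0 <= (m - b) * (m + b) by rewrite mulr_ge0//; lia.
  lia.
Qed.

(** [Bzero] is empty since [n] is odd. Each pair of divisors gets [2 hv l * d] from the diagonal and
    [2 l] from the points with [m = t], twice its share in [sigma_divpairs]. *)
Lemma shifted_forms_sum_1mod4 n : (n %% 4)%Z = 1 ->
  \sum_(x \in shifted_forms n) form_weight x.1.1.1 x.1.1.2 x.1.2 = 2 * sigma n.
Proof.
move=> n1; rewrite shifted_forms_split; last by left.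
rewrite shifted_forms_pos_sum; last by left.
rewrite Bminus_Bplus (_ : \sum_(x \in Bzero n) _ = 0); last first.
  by apply: fsbig1 => -[[m L] j] [/= _ _ _ _ e]; lia.
rewrite add0r -fsumZ Zplus_diag_sum// shifted_forms_diag_sum sigma_divpairs; last lia.
rewrite -!fsumZ -fsumD; last exact: finite_divpairs.
by apply: eq_fsbigr => x _; ring.
Qed.

(** By parity neither the diagonal nor the points with [m = t] occur, so only [Bzero]
    contributes. *)
Lemma shifted_forms_sum_2mod4 k : (k %% 2)%Z = 1 ->
  \sum_(x \in shifted_forms (2 * k)) form_weight x.1.1.1 x.1.1.2 x.1.2 = 4 * sigma k.
Proof.
move=> k1; have k4 : ((2 * k) %% 4)%Z = 1 \/ ((2 * k) %% 4)%Z = 2 by right; lia.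
rewrite shifted_forms_split// shifted_forms_pos_sum// Bminus_Bplus Bzero_sum//.
rewrite (_ : \sum_(x \in shifted_forms_diag _) _ = 0); last first.
  apply: fsbig1 => -[[m l] b] [/= [m1 m0] [l1 l0] _ _ e].
  by have := modz2_mul m (m + l); rewrite e => -[_ h]; have := h (conj m1 _); lia.
rewrite (_ : \sum_(x \in [set x | Zplus _ x /\ _]) _ = 0); last first.
  apply: fsbig1 => -[[[t m] L] J] [[/= [m1 L1] jt [t0 m0] [L0 J0] e] /= mt]; subst m.
  by have := modz2_mul t t => -[_ h]; have := h (conj m1 m1); lia.
lia.
Qed.

(** * Sums of three squares *)

Definition mixed3 (m : int) : set (int * int * int) := [set x |
  [/\ ((x.1.2 - x.1.1) %% 2)%Z = 1, ((x.2 - x.1.2) %% 2)%Z = 0 &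
   x.1.1 * x.1.1 + x.1.2 * x.1.2 + x.2 * x.2 = m]].

Definition r3 (m : int) : int := \sum_(x \in mixed3 m) (1 : int).

Lemma r3_fiber n (D : set int) : finite_set D ->
  (forall s, s * s <= n -> (s %% 2)%Z = 0 -> D s) -> (forall s, D s -> (s %% 2)%Z = 0) ->
  \sum_(s \in D) r3 (n - s * s) = \sum_(x \in mixed4 n) (1 : int).
Proof.
move=> fD sD Ds; apply/esym.
rewrite (@fsum_fiber _ _ _ D (fun x => x.2))//.
- apply: eq_fsum => // s Hs.
  apply: (@fsum_bij _ _ _ _ _ _ (fun x => x.1) (fun x => (x, s))) => [[[[x y] z] s']|[[x y] z]].
    by move=> [[/= h1 h2 h3 e] ss]; subst s'; split=> //; split=> //=; lia.
  move=> [/= h1 h2 e]; split=> //; split=> //; split=> //=; first exact: Ds.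
  lia.
- exact: finite_mixed4.
- move=> [[[x y] z] s] [/= h1 h2 h3 e]; apply: sD => //.
  have sq_ge0 (t : int) : 0 <= t * t by rewrite -expr2 sqr_ge0.
  by move: (sq_ge0 x) (sq_ge0 y) (sq_ge0 z); lia.
Qed.

Lemma r3_nonpos m : m < 0 -> r3 m = 0.
Proof.
move=> m0; apply: fsbig1 => -[[x y] z] [/= _ _ e].
have sq_ge0 (t : int) : 0 <= t * t by rewrite -expr2 sqr_ge0.
by move: (sq_ge0 x) (sq_ge0 y) (sq_ge0 z); lia.
Qed.

Lemma class_count_nonpos N : N < 0 -> class_count N = 0.
Proof.
move=> N0; apply: fsbig1 => -[[m l] b] [/= [m1 m0] [l1 l0] bm e].
have h1 : 0 <= m * l by rewrite mulr_ge0// ltW.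
have h2 : 0 <= (m - b) * (m + b) by rewrite mulr_ge0//; lia.
lia.
Qed.

(** Induction on [n]: in the two equal sums over even [s], the term [s = 0] is the value at [n], and
    the others have smaller arguments of the same residue mod 4. *)
Lemma r3_class_count n : (n %% 4)%Z = 1 \/ (n %% 4)%Z = 2 -> r3 n = class_count n.
Proof.
have [B nB] : exists B : nat, n < B by exists (`|n|%N.+1); lia.
elim: B => [|B IH] in n nB * => n12.
  by rewrite r3_nonpos// class_count_nonpos.
pose D : set int := [set s | - `|n| <= s <= `|n| /\ (s %% 2)%Z = 0].
have fD : finite_set D by apply: (@finite_box1 `|n|) => s [].
have sD s : s * s <= n -> (s %% 2)%Z = 0 -> D s.
  by move=> sn s0; split=> //; have := sqr_le_itv sn; lia.
have Ds s : D s -> (s %% 2)%Z = 0 by case.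
have eq : \sum_(s \in D) r3 (n - s * s) = \sum_(s \in D) class_count (n - s * s).
  rewrite r3_fiber// class_count_fiber//.
  case: n12 => h; first by rewrite card_mixed4_1mod4// shifted_forms_sum_1mod4.
  have -> : n = 2 * (n %/ 2)%Z by lia.
  by rewrite card_mixed4_2mod4 ?shifted_forms_sum_2mod4//; lia.
have D0 : D 0 by split; lia.
move: eq; rewrite !(@fsbigD1 _ _ _ _ 0 D)//= mulr0 subr0.
rewrite (_ : \sum_(s \in D `\ 0) r3 (n - s * s) =
             \sum_(s \in D `\ 0) class_count (n - s * s)); first by move/addIr.
apply: eq_fsum => // s [/= [sn s0] /eqP sn0].
have s1 : 0 < s * s by rewrite -expr2 lt_neqAle sqr_ge0 eq_sym expf_neq0.
by have := sqr_mod4 s => s4; apply: IH; lia.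
Qed.

(** All weights are nonnegative, so one form of positive weight suffices. The parities are kept
    because for [d] = 3 mod 4 two of the squares must be even. *)
Theorem three_squares (n : int) : 0 < n -> (n %% 4)%Z = 1 \/ (n %% 4)%Z = 2 ->
  exists x y z : int, [/\ ((y - x) %% 2)%Z = 1, ((z - y) %% 2)%Z = 0 &
    x * x + y * y + z * z = n].
Proof.
move=> n0 n12; suff : 0 < r3 n.
  move=> h; have : r3 n <> 0 by lia.
  move=> h'; apply: contrapT => hn; apply: h'; apply: fsbig1 => -[[x y] z] h3.
  by case: hn; exists x, y, z; case: h3.
rewrite r3_class_count//.
have fF : finite_set (reduced_forms n).
  have -> : reduced_forms n = fst @` [set x | shifted_forms n x /\ x.2 = 0].
    apply/seteqP; split=> [x h|_ [[x s] [h /= s0] <-]].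
      by exists (x, 0) => //; split=> //; split=> //=; rewrite mulr0 subr0.
    by case: h; rewrite /= s0 mulr0 subr0.
  by apply/finite_image/(sub_finite_set _ (finite_shifted_forms n12)) => x [].
have form_weight_ge0 m l b : - m <= b <= m -> 0 <= form_weight m l b.
  move=> bm; rewrite /form_weight mulr_ge0//; first by case: (hvP l).
  by case: (hvP (m + b)); case: (hvP (b - m)) => *; lia.
case: n12 => h.
  (* The form [X^2 + n Y^2], with [l = n - 1] even. *)
  rewrite /class_count (@fsbigD1 _ _ _ _ (1, n - 1, 0))//=; last by split=> /=; lia.
  rewrite ltr_pwDl//.
    by rewrite /form_weight; case: (hvP (n - 1)) => //; case: (hvP (1 + 0)) => //;
      case: (hvP (0 - 1)) => //; lia.
  by apply: fsumr_ge0 => -[[m l] b] [[/= _ _ bm _] _]; exact: form_weight_ge0.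
(* For even [n] the condition that [l] be even calls for [X^2 + 2 X Y + (n + 1) Y^2], with
   [l = n]. *)
rewrite /class_count (@fsbigD1 _ _ _ _ (1, n, 1))//=; last by split=> /=; lia.
rewrite ltr_pwDl//.
  by rewrite /form_weight; case: (hvP n) => //; case: (hvP (1 + 1)) => //;
    case: (hvP (1 - 1)) => //; lia.
by apply: fsumr_ge0 => -[[m l] b] [[/= _ _ bm _] _]; exact: form_weight_ge0.
Qed.

(** * Integers of imaginary quadratic fields *)

Lemma Aint_quadratic (x : algC) (s t : int) :
  x * x = s%:~R * x - t%:~R -> x \in Aint.
Proof.
move=> e; pose q : {poly algC} := (- s%:~R) *: 'X + (t%:~R)%:P.
have szq : (size q < size ('X^2 : {poly algC}))%N.
  rewrite size_polyXn ltnS (leq_trans (size_polyD _ _))// geq_max.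
  by rewrite (leq_trans (size_scale_leq _ _)) ?size_polyX// (leq_trans (size_polyC_leq1 _)).
apply: (@root_monic_Aint ('X^2 + q)).
- by rewrite rootE /q !(hornerD, hornerZ, hornerXn, hornerX, hornerC) expr2 e; apply/eqP; ring.
- by rewrite monicE lead_coefDl// lead_coefXn.
- apply/polyOverP => i; rewrite !coefD coefXn coefZ coefX coefC.
  rewrite !rpredD ?rpredM ?rpredN ?rpred_nat ?rpred_int//.
  by case: (i == 0%N); rewrite ?rpred_int ?rpred0.
Qed.

Lemma sqrtmd_sqr d : sqrtmd d * sqrtmd d = - d%:R.
Proof. by rewrite -expr2 sqrtCK. Qed.

(** The conjugate is again a square root of [- d]; were it the same one, a real number would have a
    negative square. *)
Lemma sqrtmd_conj d : (0 < d)%N -> (sqrtmd d)^* = - sqrtmd d.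
Proof.
move=> d0; have : ((sqrtmd d)^* - sqrtmd d) * ((sqrtmd d)^* + sqrtmd d) = 0.
  transitivity ((sqrtmd d)^* * (sqrtmd d)^* - sqrtmd d * sqrtmd d); first by ring.
  by rewrite -rmorphM/= sqrtmd_sqr rmorphN/= conjC_nat subrr.
move/eqP; rewrite mulf_eq0 subr_eq0 addr_eq0 => /orP[|/eqP//]; rewrite -CrealE.
move/(@real_exprn_even_ge0 _ 2 _)/(_ isT); rewrite expr2 sqrtmd_sqr.
by rewrite oppr_ge0 lern0 => /eqP d00; rewrite d00 in d0.
Qed.

Lemma inE_mul d x y : Defs.inE d x -> Defs.inE d y -> Defs.inE d (x * y).
Proof.
move=> [a [b ->]] [a' [b' ->]].
exists (a * a' - d%:R * (b * b')), (a * b' + a' * b).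
rewrite !(rmorphB, rmorphD, rmorphM)/= ratr_nat.
transitivity (ratr a * ratr a' + ratr b * ratr b' * (sqrtmd d * sqrtmd d) +
   (ratr a * ratr b' + ratr a' * ratr b) * sqrtmd d); first by ring.
by rewrite sqrtmd_sqr; ring.
Qed.

Lemma inE_add d x y : Defs.inE d x -> Defs.inE d y -> Defs.inE d (x + y).
Proof.
move=> [a [b ->]] [a' [b' ->]]; exists (a + a'), (b + b').
by rewrite !rmorphD/=; ring.
Qed.

Lemma inO_mul d x y : inO d x -> inO d y -> inO d (x * y).
Proof. by move=> [? ?] [? ?]; split; [apply: inE_mul | rewrite rpredM]. Qed.

Lemma inO_add d x y : inO d x -> inO d y -> inO d (x + y).
Proof. by move=> [? ?] [? ?]; split; [apply: inE_add | rewrite rpredD]. Qed.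

Lemma inO_int d (c : int) : inO d c%:~R.
Proof.
split; last exact: Aint_int.
by exists c%:~R, 0; rewrite rmorph0 mul0r addr0 rmorph_int.
Qed.

(** The square of the denominator of [b] is coprime to the numerator, hence divides [d], so the
    denominator is 1. *)
Lemma squarefree_sqr_mul (d : nat) (b : rat) (M : int) :
  squarefree d -> d%:R * b ^+ 2 = M%:~R -> exists B : int, b = B%:~R.
Proof.
move=> sf e; have [v1|v1] := eqVneq (denq b) 1.
  by exists (numq b); rewrite -[LHS]divq_num_den v1 divr1.
have v0 : 0 < denq b := denq_gt0 b.
have e' : d%:Z * (numq b * numq b) = M * (denq b * denq b).
  have v0' : (denq b)%:~R != 0 :> rat by rewrite intr_eq0 gt_eqF.
  apply: (@intr_inj rat); rewrite !rmorphM/= -e.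
  by move: (esym (divq_num_den b)) v0'; move: (numq b) (denq b) => u v -> v0'; field.
have dv : (`|denq b| ^ 2 %| d)%N.
  have : (`|denq b| ^ 2 %| d * `|numq b| ^ 2)%N.
    have /(congr1 absz) := e'; rewrite !abszM absz_nat !mulnn => ->.
    exact: dvdn_mull.
  rewrite Gauss_dvdl// coprimeXl// coprimeXr// coprime_sym.
  exact: coprime_num_den.
case: (sf `|denq b|%N); first by lia.
by rewrite mulnn.
Qed.

(** For [x = a + b sqrt(-d)] the trace [2 a] and the norm are rational algebraic integers, hence
    integers. So [d (2 b)^2] is an integer, and [2 b] is one because [d] is squarefree. *)
Lemma inO_half d x : (0 < d)%N -> squarefree d -> inO d x ->
  exists A B N : int, 2 * x = A%:~R + B%:~R * sqrtmd d /\ A * A + d%:Z * (B * B) = 4 * N.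
Proof.
move=> d0 sf [[a [b ex]] xA].
have xc : x^* = ratr a - ratr b * sqrtmd d.
  by rewrite ex rmorphD/= [(_ * sqrtmd d)^*]rmorphM/= sqrtmd_conj// !conj_Crat ?Crat_rat// mulrN.
have xcA : x^* \in Aint by rewrite Aint_aut.
have tr : ratr (2 * a) = x + x^* by rewrite xc ex rmorphM/= ratr_nat; ring.
have nm : ratr (a * a + d%:R * (b * b)) = x * x^*.
  rewrite xc ex !(rmorphD, rmorphM)/= ratr_nat.
  transitivity (ratr a * ratr a - ratr b * ratr b * (sqrtmd d * sqrtmd d)); last by ring.
  by rewrite sqrtmd_sqr; ring.
have /intrP[A eA] : ratr (2 * a) \in (Num.int : {pred algC}).
  by rewrite Cint_rat_Aint ?Crat_rat// tr rpredD.
have /intrP[N eN] : ratr (a * a + d%:R * (b * b)) \in (Num.int : {pred algC}).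
  by rewrite Cint_rat_Aint ?Crat_rat// nm rpredM.
have {}eA : 2 * a = A%:~R.
  by apply: (fmorph_inj (ratr : {rmorphism rat -> algC})); apply: etrans eA _; exact/esym/ratr_int.
have {}eN : a * a + d%:R * (b * b) = N%:~R.
  by apply: (fmorph_inj (ratr : {rmorphism rat -> algC})); apply: etrans eN _; exact/esym/ratr_int.
have [B eB] : exists B : int, 2 * b = B%:~R.
  apply: (@squarefree_sqr_mul d _ (4 * N - A * A)) => //.
  by rewrite rmorphB !rmorphM/= -eN -eA; ring.
exists A, B, N; split.
  have ra : 2 * ratr a = A%:~R :> algC by rewrite -(ratr_int _ A) -eA rmorphM/= ratr_nat.
  have rb : 2 * ratr b = B%:~R :> algC by rewrite -(ratr_int _ B) -eB rmorphM/= ratr_nat.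
  by rewrite ex -ra -rb; ring.
apply: (@intr_inj rat); rewrite !(rmorphD, rmorphM)/= -eN -eA -eB.
by ring.
Qed.

(** With [u p + v T = 1] for [p = 2 h + 1], take for [a] the residue of [v R] mod [p] in [[- h, h]];
    adding and then subtracting [h] centres it. *)
Lemma balanced_solution (h T R : int) : 0 <= h -> coprimez (2 * h + 1) T ->
  exists a M : int, R = (2 * h + 1) * a * a + a * T + (2 * h + 1) * M /\ - h <= a <= h.
Proof.
move=> h0 /coprimezP[[u v] /= uv].
pose p := 2 * h + 1; pose a := ((v * R + h) %% p)%Z - h.
pose q := ((v * R + h) %/ p)%Z.
have eq : v * R = p * q + a by rewrite /a /q; have := divz_eq (v * R + h) p; lia.
have ah : - h <= a <= h.
  have p0 : p != 0 by rewrite /p; lia.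
  have := modz_ge0 (v * R + h) p0; have := ltz_mod (v * R + h) p0.
  by rewrite /a /p; lia.
clearbody a q; exists a, (R * u + q * T - a * a); split=> //; rewrite -/p in uv *.
transitivity (R * (u * p + v * T)); first by rewrite uv; ring.
rewrite (_ : _ * _ = R * u * p + v * R * T); last by ring.
by rewrite eq; ring.
Qed.

(** * Representations by I_4 *)

(** The map [x |-> (x g0, x g1, x g2, x g3)] scales the form by the norm [c] of the vector, and it
    is injective because [c] is nonzero. *)
Lemma represented_of_vector d (P : algC -> Prop) (c : algC) (g0 g1 g2 g3 : algC) :
  (forall x, P x -> [/\ inO d (x * g0), inO d (x * g1), inO d (x * g2) & inO d (x * g3)]) ->
  g0 * g0^* + (g1 * g1^* + g2 * g2^* + g3 * g3^*) = c -> c != 0 ->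
  represented_by_I4 d P (unary_form c).
Proof.
move=> gO gc c0; pose g (i : 'I_4) := [:: g0; g1; g2; g3]`_i.
have gs : \sum_(i < 4) g i * (g i)^* = c.
  by rewrite !big_ord_recl big_ord0 /g/= addr0 -gc !addrA.
exists (fun x i => x * g i); split; [|split; [|split]].
- by move=> x /gO[h0 h1 h2 h3] [[|[|[|[|//]]]] /= ?].
- by move=> a x y _ _ _ i; ring.
- move=> x y _ _ /(congr1 (fun f => \sum_(i < 4) f i * (g i)^*)).
  have e z : \sum_(i < 4) z * g i * (g i)^* = z * c.
    by rewrite -gs mulr_sumr; apply: eq_bigr => i _; rewrite mulrA.
  by rewrite !e => /(mulIf c0).
- move=> x y _ _; rewrite /unary_form -gs mulr_sumr; apply: eq_bigr => i _.
  by rewrite rmorphM/=; ring.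
Qed.

Definition sqrt_pm (d : nat) (w : algC) : Prop := w = sqrtmd d \/ w = - sqrtmd d.

Lemma sqrt_pm_sqr d w : sqrt_pm d w -> w * w = - d%:R.
Proof. by case=> ->; rewrite ?mulrNN sqrtmd_sqr. Qed.

Lemma sqrt_pm_conj d w : (0 < d)%N -> sqrt_pm d w -> w^* = - w.
Proof. by move=> d0 [] ->; rewrite ?rmorphN/= sqrtmd_conj. Qed.

Lemma sqrt_pmN d w : sqrt_pm d w -> sqrt_pm d (- w).
Proof. by case=> ->; [right | left; rewrite opprK]. Qed.

Lemma inE_sqrt_pm d w (a b : rat) : sqrt_pm d w -> Defs.inE d (ratr a + ratr b * w).
Proof.
by case=> ->; [exists a, b | exists a, (- b)]; rewrite // rmorphN mulrN mulNr.
Qed.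

Lemma inO_sqrt_pm d w (x y : int) : sqrt_pm d w -> inO d (x%:~R + y%:~R * w).
Proof.
move=> hw; have w2 := sqrt_pm_sqr hw; split.
  by rewrite -[x%:~R](ratr_int algC) -[y%:~R](ratr_int algC); exact: inE_sqrt_pm.
apply: (@Aint_quadratic _ (2 * x) (x * x + d%:Z * (y * y))).
rewrite !(rmorphD, rmorphM)/=.
transitivity (x%:~R * x%:~R + 2 * x%:~R * y%:~R * w + y%:~R * y%:~R * (w * w) : algC); first by ring.
by rewrite w2; ring.
Qed.

Lemma inO_half_sqrt_pm d w (x k : int) : sqrt_pm d w -> x * x + d%:Z = 4 * k ->
  inO d ((x%:~R + w) / 2).
Proof.
move=> hw e; have w2 := sqrt_pm_sqr hw; split.
  have -> : (x%:~R + w) / 2 = ratr (x%:~R / 2) + ratr (1 / 2) * w.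
    by rewrite !fmorph_div/= ratr_int ratr_nat rmorph1; field.
  exact: inE_sqrt_pm.
apply: (@Aint_quadratic _ x k).
have e' : 4 * k%:~R = x%:~R * x%:~R + d%:R :> algC.
  by rewrite -[4]/(4%:~R) -intrM -e rmorphD rmorphM.
have -> : k%:~R = (x%:~R * x%:~R - w * w) / 4 :> algC.
  by rewrite w2 opprK -e'; field.
by field.
Qed.

(** Otherwise a Bezout relation between [p] and [c] would put 1 into [P]. *)
Lemma dvd_of_mem_prime d P (p : nat) (c : int) : is_prime_ideal d P -> prime p ->
  P p%:R -> P c%:~R -> exists c' : int, c = p%:Z * c'.
Proof.
move=> [[PO [P0 [PD PM]]] [P1 _]] pp Pp Pc.
have [/dvdzP[c' ->]|npc] := boolP (p %| c)%Z; first by exists c'; rewrite mulrC.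
case: P1; have : coprimez p c by rewrite /coprimez/= -[_ == _]/(coprime p `|c|) prime_coprime.
move=> /coprimezP[[u v] /= uv].
rewrite -[1]/(1%:~R) -uv rmorphD !rmorphM/=.
by apply: PD; apply: PM => //; exact: inO_int.
Qed.

Lemma represented_core d P (p r : nat) (v : algC) (T K a M : int) (x1 x2 x3 : algC) :
  (0 < r)%N -> is_prime_ideal d P -> prime p -> P p%:R ->
  (forall x, P x -> exists c e : int, x = c%:~R + e%:~R * v) ->
  P v -> inO d v^* -> v + v^* = T%:~R -> v * v^* = (p%:Z * K)%:~R ->
  inO d x1 -> inO d x2 -> inO d x3 -> x1 * x1^* + x2 * x2^* + x3 * x3^* = M%:~R ->
  r%:Z = p%:Z * a * a + a * T + K + p%:Z * M ->
  represented_by_I4 d P (unary_form (r%:R / p%:R)).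
Proof.
move=> r0 Pprime pp Pp Pdec Pv vO vT vK x1O x2O x3O xM er.
have p0 : p%:R != 0 :> algC by rewrite pnatr_eq0 -lt0n prime_gt0.
have [[PO [P0 [PD PM]]] _] := Pprime.
apply: (@represented_of_vector d P _ (a%:~R + v^* / p%:R) x1 x2 x3).
- move=> x Px; split; [|exact: inO_mul (PO _ Px) _..].
  have [c [e ex]] := Pdec x Px.
  have Pc : P c%:~R.
    have -> : c%:~R = x + (- e)%:~R * v by rewrite ex rmorphN/=; ring.
    by apply: PD => //; apply: PM => //; exact: inO_int.
  have [c' ec] := dvd_of_mem_prime Pprime pp Pp Pc.
  (* Here [x v^* / p = c' v^* + e K], from [c = p c'] and [v v^* = p K]. *)
  have -> : x * (a%:~R + v^* / p%:R) = x * a%:~R + (c'%:~R * v^* + (e * K)%:~R).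
    rewrite mulrDr; congr (_ + _); apply: (mulIf p0); rewrite mulrA divfK//.
    transitivity (c%:~R * v^* + e%:~R * (v * v^*)); first by rewrite ex; ring.
    by rewrite vK ec !rmorphM/=; ring.
  apply: inO_add; first by apply: inO_mul (PO _ Px) (inO_int _ _).
  by apply: inO_add; [apply: inO_mul => // |]; exact: inO_int.
- have er' : r%:R = p%:R * a%:~R * a%:~R + a%:~R * T%:~R + K%:~R + p%:R * M%:~R :> algC.
    by rewrite -[r%:R]/(r%:Z%:~R) er !(rmorphD, rmorphM).
  have -> : (a%:~R + v^* / p%:R)^* = a%:~R + v / p%:R.
    by rewrite rmorphD fmorph_div/= conjCK conjC_nat conj_intr ?intr_int.
  rewrite xM.
  have -> : (a%:~R + v^* / p%:R) * (a%:~R + v / p%:R) =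
     a%:~R * a%:~R + a%:~R * (v + v^*) / p%:R + (v * v^*) / p%:R / p%:R by field.
  by rewrite vT vK er' rmorphM/=; field.
- by rewrite mulf_neq0 ?invr_eq0// pnatr_eq0 -lt0n.
Qed.

(** Squares are 0 or 1 mod 4, so an odd [A] or [B] is impossible. With [inO_half] this says that the
    ring of integers is [Z[sqrt(-d)]]. *)
Lemma even_of_norm_12mod4 (d : nat) (A B N : int) :
  (d %% 4 = 1)%N \/ (d %% 4 = 2)%N -> A * A + d%:Z * (B * B) = 4 * N ->
  exists A' B' : int, A = 2 * A' /\ B = 2 * B'.
Proof.
move=> d4 eN.
have [D [r [hr eD]]] : exists D r : int, (r = 1 \/ r = 2) /\ d%:Z = 4 * D + r.
  by exists (d %/ 4)%N%:Z, (d %% 4)%N%:Z; lia.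
move: (d%:Z) eD eN => {d d4} d -> eN.
have [A' eA] : exists A', A = 2 * A' \/ A = 2 * A' + 1 by exists (A %/ 2)%Z; lia.
have [B' eB] : exists B', B = 2 * B' \/ B = 2 * B' + 1 by exists (B %/ 2)%Z; lia.
by exists A', B'; case: eA => eA; case: eB => eB; case: hr => hr; subst A B r; split=> //; lia.
Qed.

Lemma even_of_norm_3mod4 (d : nat) (A B N : int) :
  (d %% 4 = 3)%N -> A * A + d%:Z * (B * B) = 4 * N -> exists C : int, A - B = 2 * C.
Proof.
move=> d4 eN.
have [D eD] : exists D : int, d%:Z = 4 * D + 3 by exists (d %/ 4)%N%:Z; lia.
move: (d%:Z) eD eN => {d d4} d -> eN.
have [A' eA] : exists A', A = 2 * A' \/ A = 2 * A' + 1 by exists (A %/ 2)%Z; lia.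
have [B' eB] : exists B', B = 2 * B' \/ B = 2 * B' + 1 by exists (B %/ 2)%Z; lia.
by exists (A' - B'); case: eA => eA; case: eB => eB; subst A B; lia.
Qed.

Lemma sum_norms_12mod4 d (M : int) : (0 < d)%N -> d%:Z * 2 <= M ->
  (d %% 4 = 1)%N \/ (d %% 4 = 2)%N ->
  exists x1 x2 x3 : algC, [/\ inO d x1, inO d x2, inO d x3 &
    x1 * x1^* + x2 * x2^* + x3 * x3^* = M%:~R].
Proof.
move=> d0 dM d4; pose w := sqrtmd d; have hw : sqrt_pm d w by left.
(* [y1] and [y2] in [{0, 1}] count how often [d] is subtracted. Since [M >= 2 d], the remainder is
   nonnegative, and being 1 or 2 mod 4 it is not 0. *)
have [y1 [y2 [m0 m12]]] : exists y1 y2 : int, 0 < M - d%:Z * (y1 * y1) - d%:Z * (y2 * y2) /\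
    (((M - d%:Z * (y1 * y1) - d%:Z * (y2 * y2)) %% 4)%Z = 1 \/
     ((M - d%:Z * (y1 * y1) - d%:Z * (y2 * y2)) %% 4)%Z = 2).
  have [h|h] : (M %% 4)%Z \in [:: 1; 2] \/ (M %% 4)%Z \in [:: 0; 3].
  - by rewrite !inE; lia.
  - by exists 0, 0; move: h; rewrite !inE; lia.
  have [h'|h'] : ((M - d%:Z) %% 4)%Z \in [:: 1; 2] \/ ((M - d%:Z) %% 4)%Z \notin [:: 1; 2].
  - by case: (_ \in _); [left | right].
  - by exists 1, 0; move: h'; rewrite !inE; lia.
  by exists 1, 1; move: h h'; rewrite !inE; lia.
have [x [y [z [_ _ e]]]] := three_squares m0 m12.
exists (x%:~R + y1%:~R * w), (y%:~R + y2%:~R * w), (z%:~R).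
split; [exact: inO_sqrt_pm | exact: inO_sqrt_pm | exact: inO_int |].
have conj (u v : int) : (u%:~R + v%:~R * w)^* = u%:~R - v%:~R * w.
  by rewrite rmorphD rmorphM/= (sqrt_pm_conj d0 hw) !conj_intr ?intr_int// mulrN.
have -> : M = x * x + y * y + z * z + d%:Z * (y1 * y1) + d%:Z * (y2 * y2) by lia.
rewrite !conj conj_intr ?intr_int// !(rmorphD, rmorphM)/=.
transitivity (x%:~R * x%:~R + y%:~R * y%:~R + z%:~R * z%:~R -
  (w * w) * (y1%:~R * y1%:~R) - (w * w) * (y2%:~R * y2%:~R) : algC); first by ring.
by rewrite (sqrt_pm_sqr hw); ring.
Qed.

(** In [4 M - d = x^2 + y^2 + z^2] the entry [x] is odd and [y], [z] are even, so [M] is the norm of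
    [(x + sqrt(-d)) / 2] plus [(y / 2)^2 + (z / 2)^2]. *)
Lemma sum_norms_3mod4 d (M : int) : (0 < d)%N -> d%:Z + 1 <= 4 * M ->
  (d %% 4 = 3)%N ->
  exists x1 x2 x3 : algC, [/\ inO d x1, inO d x2, inO d x3 &
    x1 * x1^* + x2 * x2^* + x3 * x3^* = M%:~R].
Proof.
move=> d0 dM d4; pose w := sqrtmd d; have hw : sqrt_pm d w by left.
have m0 : 0 < 4 * M - d%:Z by lia.
have m1 : ((4 * M - d%:Z) %% 4)%Z = 1 \/ ((4 * M - d%:Z) %% 4)%Z = 2 by left; lia.
have [x [y [z [xy yz e]]]] := three_squares m0 m1.
have sq4 (t : int) : exists q, t * t = 4 * q + (t %% 2)%Z.
  have [h|h] : t = 2 * (t %/ 2)%Z \/ t = 2 * (t %/ 2)%Z + 1 by lia.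
    by exists ((t %/ 2)%Z * (t %/ 2)%Z); rewrite {1 2 5}h; lia.
  by exists ((t %/ 2)%Z * (t %/ 2)%Z + (t %/ 2)%Z); rewrite {1 2 6}h; lia.
have [qx ex] := sq4 x; have [qy ey] := sq4 y; have [qz ez] := sq4 z.
have [y' hy] : exists y', y = 2 * y' by exists (y %/ 2)%Z; lia.
have [z' hz] : exists z', z = 2 * z' by exists (z %/ 2)%Z; lia.
exists ((x%:~R + w) / 2), y'%:~R, z'%:~R.
split; [|exact: inO_int|exact: inO_int|].
  by apply: (@inO_half_sqrt_pm _ _ _ (M - y' * y' - z' * z')) => //; subst y z; lia.
rewrite fmorph_div/= rmorphD/= (sqrt_pm_conj d0 hw) !conj_intr ?intr_int//.
have -> : (x%:~R + w) / 2 * ((x%:~R - w) / 2) = (x%:~R * x%:~R - w * w) / 4 by field.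
have e' : 4 * M%:~R = x%:~R * x%:~R + 4 * (y'%:~R * y'%:~R) + 4 * (z'%:~R * z'%:~R) + d%:R :> algC.
  have -> : 4 * M%:~R = (4 * M)%:~R :> algC by rewrite rmorphM.
  rewrite (_ : 4 * M = x * x + 4 * (y' * y') + 4 * (z' * z') + d%:Z).
    by rewrite !(rmorphD, rmorphM).
  by subst y z; lia.
have -> : M%:~R = (4 * M%:~R) / 4 :> algC by field.
by rewrite e' (sqrt_pm_sqr hw); field.
Qed.

(** * The theorem in the two cases of [d] mod 4 *)

Lemma prime_mem_conj d P (p : nat) (x y : algC) (K : int) :
  is_prime_ideal d P -> P p%:R -> inO d x -> inO d y -> x * y = (p%:Z * K)%:~R ->
  P x \/ P y.
Proof.
move=> [[PO [P0 [PD PM]]] [_ Pxy]] Pp xO yO e; apply: Pxy => //.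
by rewrite e rmorphM/= mulrC; apply: PM => //; exact: inO_int.
Qed.

Lemma represented_12mod4 d P (p n r : nat) :
  (0 < d)%N -> squarefree d -> is_prime_ideal d P -> prime p -> P p%:R -> odd p ->
  ~~ (p %| d)%N -> (d %% 4 = 1)%N \/ (d %% 4 = 2)%N -> (p %| n ^ 2 + d)%N ->
  (0 < r)%N -> boundC d p n <= r%:R ->
  represented_by_I4 d P (unary_form (r%:R / p%:R)).
Proof.
move=> d0 sf Pprime pp Pp op npd d4 /dvdnP[K eK] r0 rC.
have p0 := prime_gt0 pp.
have [h ph] : exists h : nat, p = (2 * h + 1)%N by exists p./2; lia.
have pn : ~~ (p %| n)%N.
  apply: contra npd => pn; have : (p %| n ^ 2 + d)%N by rewrite eK dvdn_mull.
  by rewrite dvdn_addr// dvdn_mulr.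
(* The trace [2 n] is invertible mod [p]: [p] is odd, and it does not divide [n] since it does not
   divide [d]. *)
have cop : coprimez (2 * h%:Z + 1) (2 * n%:Z).
  rewrite (_ : 2 * h%:Z + 1 = p%:Z); last by lia.
  rewrite (_ : 2 * n%:Z = (2 * n)%N%:Z); last by lia.
  rewrite /coprimez/= -[_ == _]/(coprime p (2 * n)) coprimeMr coprimen2 op/=.
  by rewrite prime_coprime.
have [a [M [er ah]]] := balanced_solution (r%:Z - K%:Z) (isT : 0 <= h%:Z) cop.
(* The constant [C], rewritten with [p = 2 h + 1] and [n^2 + d = K p]. *)
have rC' : (p * h ^ 2 + 2 * h * n + K + 2 * p * d <= r)%N.
  rewrite -(ler_nat rat); apply: le_trans rC; rewrite le_eqVlt; apply/orP; left.
  have pz : p%:R != 0 :> rat by rewrite pnatr_eq0 -lt0n.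
  have eK' : d%:R + n%:R ^+ 2 = K%:R * p%:R :> rat by rewrite -natrM -eK natrD natrX addrC.
  have e3 : (d %% 4 == 3)%N = false by case: d4 => ->.
  by rewrite /boundC e3 eK' mulfK// ph !(natrD, natrM, natrX); apply/eqP; field.
have dM : d%:Z * 2 <= M.
  have a2 : a * a <= h%:Z * h%:Z.
    have : 0 <= (h%:Z - a) * (h%:Z + a) by rewrite mulr_ge0//; lia.
    lia.
  have an : a * n%:Z <= h%:Z * n%:Z by apply: ler_wpM2r => //; lia.
  have : p%:Z * (a * a) <= p%:Z * (h%:Z * h%:Z) by apply: ler_wpM2l.
  have : (p * (d * 2))%N%:Z <= p%:Z * M -> (d * 2)%N%:Z <= M.
    by rewrite PoszM ler_pM2l.
  move: rC'; rewrite -lez_nat expnS expn1 !(PoszD, PoszM).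
  rewrite (_ : 2 * h%:Z + 1 = p%:Z) in er; last by lia.
  by lia.
have [x1 [x2 [x3 [x1O x2O x3O xM]]]] := sum_norms_12mod4 d0 dM d4.
have norm w : sqrt_pm d w -> (n%:R + w) * (n%:R - w) = (p%:Z * K%:Z)%:~R.
  move=> hw; have w2 := sqrt_pm_sqr hw.
  have -> : (n%:R + w) * (n%:R - w) = n%:R * n%:R - w * w by ring.
  rewrite w2 opprK -natrM -natrD -[RHS]/((p * K)%N%:R) mulnn eK mulnC//.
have conj w : sqrt_pm d w -> (n%:R + w)^* = n%:R - w.
  by move=> hw; rewrite rmorphD/= conjC_nat (sqrt_pm_conj d0 hw).
have nO w : sqrt_pm d w -> inO d (n%:R + w).
  by move=> hw; have := @inO_sqrt_pm d w n%:Z 1 hw; rewrite mulr1z mul1r; exact.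
have [w hw Pv] : exists2 w, sqrt_pm d w & P (n%:R + w).
  have hw : sqrt_pm d (sqrtmd d) by left.
  have hw' := sqrt_pmN hw.
  have [?|?] := prime_mem_conj Pprime Pp (nO _ hw) (nO _ hw') (norm _ hw).
    by exists (sqrtmd d).
  by exists (- sqrtmd d).
apply: (@represented_core d P p r (n%:R + w) (2 * n%:Z) K%:Z a M x1 x2 x3) => //.
- move=> x Px; have xO : inO d x by case: Pprime => -[+ _] _; apply.
  have [A [B [N [ex eN]]]] := inO_half d0 sf xO.
  have {ex} [B' ex] : exists B' : int, 2 * x = A%:~R + B'%:~R * w /\ B' * B' = B * B.
    case: hw => ->; [exists B | exists (- B)]; rewrite ?mulrNN//.
    by split=> //; rewrite ex rmorphN/= mulrNN.
  case: ex => ex eB; rewrite -eB in eN.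
  have [A' [B1 [eA eB1]]] := even_of_norm_12mod4 d4 eN.
  (* Coordinates of [x = A' + B1 w] in the basis [1], [n + w]. *)
  exists (A' - B1 * n%:Z), B1; apply: (@mulfI _ 2); first by rewrite pnatr_eq0.
  by rewrite ex eA eB1 rmorphB !rmorphM/=; ring.
- by rewrite conj//; exact: nO (sqrt_pmN hw).
- by rewrite conj// rmorphM/=; ring.
- by rewrite conj// norm.
- rewrite (_ : 2 * h%:Z + 1 = p%:Z) in er; last by lia.
  by lia.
Qed.

Lemma represented_3mod4 d P (p n r : nat) :
  (0 < d)%N -> squarefree d -> is_prime_ideal d P -> prime p -> P p%:R -> odd p ->
  ~~ (p %| d)%N -> (d %% 4 = 3)%N -> (p %| n ^ 2 + d)%N -> odd n ->
  (0 < r)%N -> boundC d p n <= r%:R ->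
  represented_by_I4 d P (unary_form (r%:R / p%:R)).
Proof.
move=> d0 sf Pprime pp Pp op npd d4 pnd on r0 rC.
have p0 := prime_gt0 pp.
have [h ph] : exists h : nat, p = (2 * h + 1)%N by exists p./2; lia.
have [n' en] : exists n' : nat, n = (2 * n' + 1)%N by exists n./2; lia.
have [D eD] : exists D : nat, (d + 1 = 4 * D)%N by exists (d %/ 4).+1; lia.
(* For odd [n] and [d] = 3 mod 4, both 4 and the odd prime [p] divide [n^2 + d]; [p K] is the norm
   of [(n + w) / 2]. *)
have [K eK] : exists K : nat, (n ^ 2 + d = 4 * (p * K))%N.
  have e4 : (n ^ 2 + d = 4 * (n' ^ 2 + n' + D))%N by rewrite en; lia.
  move: pnd; rewrite e4 Gauss_dvdr; last by rewrite (coprimeXr 2 (n := 2)) ?coprimen2.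
  by move=> /dvdnP[K ->]; exists K; rewrite [(K * p)%N]mulnC.
have pn : ~~ (p %| n)%N.
  by apply: contra npd => pn; move: pnd; rewrite dvdn_addr// dvdn_mulr.
have cop : coprimez (2 * h%:Z + 1) n%:Z.
  rewrite (_ : 2 * h%:Z + 1 = p%:Z); last by lia.
  by rewrite /coprimez/= -[_ == _]/(coprime p n) prime_coprime.
have [a [M [er ah]]] := balanced_solution (r%:Z - K%:Z) (isT : 0 <= h%:Z) cop.
(* Now [(d + n^2) / p] is [4 K] and [(p - 1) n] is [2 h n]; they dominate the terms [K] and [a n],
   which leaves [p M >= p D]. *)
have rC' : (p * h ^ 2 + 2 * h * n + 4 * K + p * D <= r)%N.
  rewrite -(ler_nat rat); apply: le_trans rC; rewrite le_eqVlt; apply/orP; left.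
  have pz : p%:R != 0 :> rat by rewrite pnatr_eq0 -lt0n.
  have eK' : d%:R + n%:R ^+ 2 = (4 * K%:R) * p%:R :> rat.
    by rewrite -natrX -natrD addnC eK !natrM; ring.
  have eD' : d%:R + 1 = 4 * D%:R :> rat by rewrite -[1]/(1%:R) -natrD eD natrM.
  have e3 : (d %% 4 == 3)%N by rewrite d4.
  by rewrite /boundC e3 eK' eD' mulfK// ph !(natrD, natrM, natrX); apply/eqP; field.
have dM : d%:Z + 1 <= 4 * M.
  have a2 : a * a <= h%:Z * h%:Z.
    have : 0 <= (h%:Z - a) * (h%:Z + a) by rewrite mulr_ge0//; lia.
    lia.
  have an : a * n%:Z <= h%:Z * n%:Z by apply: ler_wpM2r => //; lia.
  have hn : 0 <= h%:Z * n%:Z by rewrite mulr_ge0.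
  have pa : p%:Z * (a * a) <= p%:Z * (h%:Z * h%:Z) by apply: ler_wpM2l.
  have DM : (p * D)%N%:Z <= p%:Z * M -> D%:Z <= M by rewrite PoszM ler_pM2l.
  move: rC'; rewrite -lez_nat expnS expn1 !(PoszD, PoszM) => rC'.
  rewrite (_ : 2 * h%:Z + 1 = p%:Z) in er; last by lia.
  have : D%:Z <= M by apply: DM; rewrite PoszM; lia.
  lia.
have [x1 [x2 [x3 [x1O x2O x3O xM]]]] := sum_norms_3mod4 d0 dM d4.
have eK4 : n%:Z * n%:Z + d%:Z = 4 * (p%:Z * K%:Z).
  by rewrite -!PoszM -PoszD mulnn eK PoszM.
have norm w : sqrt_pm d w -> (n%:Z%:~R + w) / 2 * ((n%:Z%:~R - w) / 2) = (p%:Z * K%:Z)%:~R.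
  move=> hw; have w2 := sqrt_pm_sqr hw.
  have -> : (n%:Z%:~R + w) / 2 * ((n%:Z%:~R - w) / 2) = (n%:Z%:~R * n%:Z%:~R - w * w) / 4 by field.
  have : (n%:Z * n%:Z + d%:Z)%:~R = (4 * (p%:Z * K%:Z))%:~R :> algC by rewrite eK4.
  rewrite w2 opprK [in LHS]rmorphD rmorphM/= => ->.
  by rewrite rmorphM/= mulrAC mulfV ?mul1r// pnatr_eq0.
have conj w : sqrt_pm d w -> ((n%:Z%:~R + w) / 2)^* = (n%:Z%:~R - w) / 2.
  move=> hw; rewrite fmorph_div/= rmorphD/= (sqrt_pm_conj d0 hw).
  by rewrite !conj_intr ?intr_int.
have nO w : sqrt_pm d w -> inO d ((n%:Z%:~R + w) / 2).
  by move=> hw; apply: inO_half_sqrt_pm hw eK4.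
have [w hw Pv] : exists2 w, sqrt_pm d w & P ((n%:Z%:~R + w) / 2).
  have hw : sqrt_pm d (sqrtmd d) by left.
  have hw' := sqrt_pmN hw.
  have [?|?] := prime_mem_conj Pprime Pp (nO _ hw) (nO _ hw') (norm _ hw).
    by exists (sqrtmd d).
  by exists (- sqrtmd d).
have cO : inO d ((n%:Z%:~R + w) / 2)^* by rewrite conj//; exact: nO (sqrt_pmN hw).
have cT : (n%:Z%:~R + w) / 2 + ((n%:Z%:~R + w) / 2)^* = n%:Z%:~R by rewrite conj//; field.
have cN : (n%:Z%:~R + w) / 2 * ((n%:Z%:~R + w) / 2)^* = (p%:Z * K%:Z)%:~R.
  by rewrite conj// norm.
have er' : r%:Z = p%:Z * a * a + a * n%:Z + K%:Z + p%:Z * M.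
  by rewrite (_ : p%:Z = 2 * h%:Z + 1); lia.
apply: represented_core cO cT cN x1O x2O x3O xM er' => //.
  move=> x Px; have xO : inO d x by case: Pprime => -[+ _] _; apply.
  have [A [B [N [ex eN]]]] := inO_half d0 sf xO.
  have {ex} [B' ex] : exists B' : int, 2 * x = A%:~R + B'%:~R * w /\ B' * B' = B * B.
    case: hw => ->; [exists B | exists (- B)]; rewrite ?mulrNN//.
    by split=> //; rewrite ex rmorphN/= mulrNN.
  case: ex => ex eB; rewrite -eB in eN.
  have [C eC] := even_of_norm_3mod4 d4 eN.
  exists (C - n'%:Z * B'), B'; apply: (@mulfI _ 2); first by rewrite pnatr_eq0.
  (* Coordinates in the basis [1], [(n + w) / 2], from [A = B' + 2 C] and [n = 2 n' + 1]. *)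
  have eA : A = 2 * (C - n'%:Z * B') + n%:Z * B'.
    have -> : n%:Z = 2 * n'%:Z + 1 by rewrite en PoszD PoszM.
    by rewrite -[LHS](subrK B') eC; ring.
  by rewrite ex eA rmorphD !rmorphM/=; field.
Qed.

Theorem theorem3 (d : nat) (P : algC -> Prop) (p n : nat) :
  (0 < d)%N -> squarefree d -> class_number_ge4 d ->
  is_prime_ideal d P -> ~ is_principal d P ->
  prime p -> P (p%:R) ->
  odd p -> ~~ (p %| d)%N ->
  least_n d p n ->
  forall r : nat, (0 < r)%N -> boundC d p n <= r%:R ->
    represented_by_I4 d P (unary_form (r%:R / p%:R)).
Proof.
move=> d0 sf _ Pprime _ pp Pp op npd [/and3P[n0 pnd n3] _] r r0 rC.
have d40 : (d %% 4 != 0)%N by apply/eqP => h; apply: (sf 2) => //; rewrite /dvdn h.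
have [d3|d3] := eqVneq (d %% 4)%N 3%N.
  by apply: represented_3mod4 rC => //; move: n3; rewrite d3.
have d12 : (d %% 4 = 1)%N \/ (d %% 4 = 2)%N.
  move: d40 d3; have := ltn_pmod d (isT : (0 < 4)%N).
  by case: (d %% 4)%N => [|[|[|[|]]]]; auto.
exact: represented_12mod4 d12 pnd r0 rC.
Qed.
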